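(* Suppose $E\subseteq\mathbb{R}^{n+1}$ is a nonempty closed set, $\theta>1$, $\alpha>0$ and $0<\gamma<1$. If $\operatorname{dist}_p(\cdot,E)^{-\alpha(n+p)}\in A_1^+(\gamma)$, then $E$ is $(c_0,\delta_0,\theta)$-weakly porous for some $c_0,\delta_0\in(0,1)$. Moreover, there exists a constant $C=C(n,p,d,\gamma,\theta,\alpha,E)>0$ such that for any $0<\delta\le\delta_0$ the set $E$ is $(c,\delta,\theta)$-weakly porous for some $0<c<1$ satisfying $$1-c\le C\delta^\alpha.$$
   Context: Throughout, $n\ge 1$ is an integer, $1<p<\infty$, and $d\ge1$ is a fixed integer with $dp\ge\log_2 9$. Points of $\mathbb{R}^{n+1}$ are written $(x,t)$ with $x\in\mathbb{R}^n$, $t\in\mathbb{R}$; $|\cdot|$ is Lebesgue measure. Parabolic metric: $\operatorname{dist}_p((x,t),(y,s))=\max\{\|x-y\|_\infty,|t-s|^{1/p}\}$; $\operatorname{dist}_p((x,t),E)=\inf_{(y,s)\in E}\operatorname{dist}_p((x,t),(y,s))$. Parabolic rectangles: for $x\in\mathbb{R}^n$, $t\in\mathbb{R}$, $L>0$, $0\le\gamma\le1/2$, let $Q(x,L)=\prod_{i}[x_i-L/2,x_i+L/2)$ and $R(\gamma)=R(x,t,L,\gamma)=Q(x,L)\times[t-L^p,t-\gamma L^p)$. Side lengths: $l_x(R(\gamma))=L$, $l_t(R(\gamma))=(1-\gamma)L^p$. For $\theta\in\mathbb{R}$, $R^\theta(\gamma)=R(\gamma)+(0,\theta\, l_t(R(\gamma)))$.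 Dyadic lattice: $\mathcal{D}_1(R(\gamma))$ is the partition of $R(\gamma)$ obtained by dividing each spatial edge into $2^d$ equal half-open intervals and the temporal edge into $k$ equal half-open intervals, where $k=\lceil 2^{dp}\rceil$ if $0\le\gamma\le 1-\frac{2^{dp}+1}{2^{dp+1}}$ and $k=\lfloor2^{dp}\rfloor$ if $1-\frac{2^{dp}+1}{2^{dp+1}}<\gamma\le\frac12$. Its members are again parabolic rectangles with truncation parameter in $[0,1/2]$. Put $\mathcal{D}_0(R(\gamma))=\{R(\gamma)\}$, $\mathcal{D}_{i+1}(R(\gamma))=\bigcup_{P\in\mathcal{D}_i(R(\gamma))}\mathcal{D}_1(P)$, $\mathcal{D}(R(\gamma))=\bigcup_{i\ge0}\mathcal{D}_i(R(\gamma))$. Weak porosity: for a nonempty closed $E$, a set $A$ is $E$-free if $A\cap E=\emptyset$. $\mathcal{F}(R(\gamma_0))$ is the collection of maximal (with respect to inclusion) $E$-free members of $\mathcal{D}(R(\gamma_0))$, and $\mathcal{M}(R(\gamma_0))\in\mathcal{F}(R(\gamma_0))$ is a member with largest $l_x$ ($\mathcal{M}(R(\gamma_0))=\emptyset$ if $\mathcal{F}(R(\gamma_0))=\emptyset$). For $c,\delta\in(0,1)$, $\theta\in\mathbb{R}$, $E$ is $(c,\delta,\theta)$-weakly porous if for every parabolic rectangle $R(\gamma_0)$ with $0\le\gamma_0\le1/2$ there are finitely many pairwise disjoint $E$-free $P_1,\dots,P_N\in\mathcal{D}(R(\gamma_0))$ with $|P_k|\ge\delta|\mathcal{M}(R^\theta(\gamma_0))|$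 for all $k$ and $\sum_{k=1}^N|P_k|\ge c|R(\gamma_0)|$. Parabolic Muckenhoupt class: for $0<\gamma<1$ let $R^-(\gamma)=Q(x,L)\times(t-L^p,t-\gamma L^p)$ and $R^+(\gamma)=Q(x,L)\times(t+\gamma L^p,t+L^p)$. A nonnegative $w\in L^1_{\mathrm{loc}}(\mathbb{R}^{n+1})$ belongs to $A_1^+(\gamma)$ if there is $C>0$ with $\frac{1}{|R^-(\gamma)|}\int_{R^-(\gamma)}w\,dx\,dt\le C\operatorname{ess\,inf}_{R^+(\gamma)}w$ for all such pairs (all $x,t,L$). *)

(* Defs.v *)
From HB Require Import structures.
From mathcomp Require Import all_boot all_order all_algebra.
From mathcomp Require Import all_classical all_reals all_analysis.
From mathcomp Require Import measurable_realfun ess_sup_inf.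
Set Implicit Arguments.
Unset Strict Implicit.
Unset Printing Implicit Defensive.
Import Order.TTheory GRing.Theory Num.Def Num.Theory.
Import numFieldNormedType.Exports.

Local Open Scope classical_set_scope.
Local Open Scope ring_scope.

(* The library has no Lebesgue measure on R^n for n > 1.  We put on 'rV[R]_n
   the product sigma-algebra, which is its Borel sigma-algebra, and iterate the
   product of the one-dimensional Lebesgue measure. *)

Definition measure_rV_display : measure_display -> measure_display.
Proof. exact. Qed.

Section measurable_rV.
Context {d} {T : sigmaRingType d}.
Variable n : nat.

Let coords : 'I_n -> 'rV[T]_n -> T := fun i x => x ord0 i.

Let rV_set0 : g_sigma_preimage coords set0.
Proof. exact: sigma_algebra0. Qed.

Let rV_setC A : g_sigma_preimage coords A -> g_sigma_preimage coords (~` A).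
Proof. exact: sigma_algebraC. Qed.

Let rV_bigcup (F : _^nat) : (forall i, g_sigma_preimage coords (F i)) ->
  g_sigma_preimage coords (\bigcup_i (F i)).
Proof. exact: sigma_algebra_bigcup. Qed.

HB.instance Definition _ := @isMeasurable.Build (measure_rV_display d)
  'rV[T]_n (g_sigma_preimage coords) rV_set0 rV_setC rV_bigcup.

End measurable_rV.

Definition rV_snoc (R : Type) (n : nat) (z : 'rV[R]_n * R) : 'rV[R]_n.+1 :=
  \row_i oapp (fun j => z.1 ord0 j) z.2 (unlift ord_max i).

Section lebesgue_rV.
Variable R : realType.

Fixpoint lebesgue_rV (n : nat) : set 'rV[R]_n -> \bar R :=
  match n with
  | 0 => dirac (0 : 'rV[R]_0)
  | n'.+1 => pushforward (lebesgue_rV (n := n') \x @lebesgue_measure R)%E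
               (@rV_snoc R n' : 'rV[R]_n' * measurableTypeR R -> 'rV[R]_n'.+1)
  end.

Lemma measurable_coord n (i : 'I_n) :
  measurable_fun setT (fun x : 'rV[R]_n => x ord0 i).
Proof.
move=> _ Y mY; rewrite setTI; apply: sub_sigma_algebra => /=.
rewrite -bigcup_seq/=; exists i => /=; first by rewrite mem_index_enum.
by exists Y => //; rewrite setTI.
Qed.

Lemma measurable_rVP d (T : measurableType d) n (f : T -> 'rV[R]_n) :
  (forall i, measurable_fun setT (fun x => f x ord0 i)) -> measurable_fun setT f.
Proof.
move=> mf.
suff H : g_sigma_preimage (fun i x => f x ord0 i) `<=` measurable.
  move=> _ A mA; apply: H; rewrite setTI.
  have := @g_sigma_preimage_comp _ R n 'rV[R]_n (fun i x => x ord0 i) T f.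
  by rewrite /comp => ->; exists A => //; rewrite setTI.
apply: smallest_sub; first exact: sigma_algebra_measurable.
rewrite -bigcup_seq/=; apply: bigcup_sub => i _.
by move=> A [B mB <-]; exact: mf.
Qed.

Lemma measurable_rV_snoc n : measurable_fun setT
  (@rV_snoc R n : 'rV[R]_n * measurableTypeR R -> 'rV[R]_n.+1).
Proof.
apply: measurable_rVP => i; rewrite /rV_snoc.
case: (unliftP ord_max i) => [j ->|->].
  rewrite (_ : (fun _ => _) = (fun x : 'rV[R]_n => x ord0 j) \o fst).
    by apply: measurableT_comp; [exact: measurable_coord|exact: measurable_fst].
  by apply/funext => x /=; rewrite mxE liftK.
rewrite (_ : (fun _ => _) = snd); first exact: measurable_snd.
by apply/funext => x /=; rewrite mxE unlift_none.
Qed.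

Lemma lebesgue_rV_is_measure n :
  exists m : {measure set 'rV[R]_n -> \bar R}, lebesgue_rV (n := n) = m.
Proof.
elim: n => [|n [m IHm]] /=; first by exists (dirac (0 : 'rV[R]_0)).
pose mS := measure_function_pushforward__canonical__measure_function_Measure
  (m \x @lebesgue_measure R)%E (measurable_rV_snoc (n := n)).
by exists mS; rewrite IHm.
Qed.

Let lebesgue_rV0 n : lebesgue_rV (n := n) set0 = 0%E.
Proof. by have [m ->] := lebesgue_rV_is_measure n; exact: measure0. Qed.

Let lebesgue_rV_ge0 n A : (0 <= lebesgue_rV (n := n) A)%E.
Proof. by have [m ->] := lebesgue_rV_is_measure n; exact: measure_ge0. Qed.

Let lebesgue_rV_sigma_additive n : semi_sigma_additive (lebesgue_rV (n := n)).
Proof.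
have [m ->] := lebesgue_rV_is_measure n.
exact: measure_semi_sigma_additive.
Qed.

HB.instance Definition _ n := isMeasure.Build _ _ _ (@lebesgue_rV n)
  (@lebesgue_rV0 n) (@lebesgue_rV_ge0 n) (@lebesgue_rV_sigma_additive n).

Lemma lebesgue_rV_box n (a b : 'rV[R]_n) :
  (forall i, a ord0 i <= b ord0 i) ->
  lebesgue_rV [set x : 'rV[R]_n | forall i, a ord0 i <= x ord0 i < b ord0 i] =
  (\prod_(i < n) (b ord0 i - a ord0 i))%:E.
Proof.
elim: n a b => [|n IHn] a b ab.
  rewrite big_ord0 /= diracE mem_set//= => -[] //.
pose a' : 'rV[R]_n := \row_i a ord0 (lift ord_max i).
pose b' : 'rV[R]_n := \row_i b ord0 (lift ord_max i).
have mB : measurable [set x : 'rV[R]_n | forall i, a' ord0 i <= x ord0 i < b' ord0 i].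
  rewrite (_ : [set _ | _] = \bigcap_(i in [set: 'I_n])
    ((fun x : 'rV[R]_n => x ord0 i) @^-1` `[a' ord0 i, b' ord0 i[)).
    apply: fin_bigcap_measurable => // i _; rewrite -[X in measurable X]setTI.
    exact: measurable_coord.
  apply/seteqP; split => [x H i _ /=|x H i]; first by rewrite in_itv /=.
  by have := H i I; rewrite /= in_itv.
rewrite /= /pushforward (_ : _ @^-1` _ =
   [set x : 'rV[R]_n | forall i, a' ord0 i <= x ord0 i < b' ord0 i] `*`
   [set` `[a ord0 ord_max, b ord0 ord_max[]).
  have [m mE] := lebesgue_rV_is_measure n.
  rewrite mE product_measure1E//.
  rewrite -mE IHn; last by move=> i; rewrite !mxE.
  have := @lebesgue_measure_itv R `[a ord0 ord_max, b ord0 ord_max[.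
  rewrite /= => ->; rewrite lte_fin big_ord_recr /=.
  have -> : (if a ord0 ord_max < b ord0 ord_max
    then ((b ord0 ord_max)%:E - (a ord0 ord_max)%:E)%E else 0%E)
    = (b ord0 ord_max - a ord0 ord_max)%:E.
    by have := ab ord_max; case: ltgtP => // -> _; rewrite subrr.
  rewrite -EFinM; congr (_ * _)%:E; apply: eq_bigr => i _; rewrite !mxE.
  by congr (b _ _ - a _ _); apply/val_inj; rewrite /= /bump leqNgt ltn_ord.
apply/seteqP; split => [[x t] /= H|[x t] /= [H]].
  split; last by have := H ord_max; rewrite mxE unlift_none /= in_itv.
  by move=> i; have := H (lift ord_max i); rewrite !mxE liftK.
rewrite in_itv /= => Ht i; rewrite mxE.
case: (unliftP ord_max i) => [j ->|->] //=.
by have := H j; rewrite !mxE.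
Qed.

End lebesgue_rV.

Definition lebesgue_spacetime (R : realType) (n : nat) :
    {measure set ('rV[R]_n * measurableTypeR R) -> \bar R} :=
  (lebesgue_rV (n := n) \x @lebesgue_measure R)%E.

(* `| x - y | on 'rV[R]_n is the library's sup norm. *)
Definition parabolic_dist (R : realType) (n : nat) (p : R)
    (z z' : 'rV[R]_n * R) : R :=
  Num.max `|z.1 - z'.1| (`|z.2 - z'.2| `^ p^-1).

Definition parabolic_setdist (R : realType) (n : nat) (p : R)
    (E : set ('rV[R]_n * R)) (z : 'rV[R]_n * R) : R :=
  inf [set parabolic_dist p z z' | z' in E].

(* R(x, t, L, gamma) is given by its parameters [Prect x t L gamma]. *)
Record prect (R : realType) (n : nat) := Prect {
  ctr_x : 'rV[R]_n ;
  t_top : R ;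
  l_x : R ;
  truncation : R }.

Section rectangles.
Variables (R : realType) (n : nat).
Implicit Types (p c delta theta gamma : R) (d : nat) (P Q : prect R n).
Implicit Types (E : set ('rV[R]_n * R)).

Definition parabolic P : Prop := 0 < l_x P /\ 0 <= truncation P <= 1 / 2.

Definition spatial_cube (x : 'rV[R]_n) (L : R) : set 'rV[R]_n :=
  [set y | forall i, x ord0 i - L / 2 <= y ord0 i < x ord0 i + L / 2].

Definition prect_set p P : set ('rV[R]_n * R) :=
  spatial_cube (ctr_x P) (l_x P) `*`
  [set s | t_top P - l_x P `^ p <= s < t_top P - truncation P * l_x P `^ p].

Definition l_t p P : R := (1 - truncation P) * l_x P `^ p.

Definition time_shift p theta P : prect R n :=
  Prect (ctr_x P) (t_top P + theta * l_t p P) (l_x P) (truncation P).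

Definition time_parts p d gamma : nat :=
  if gamma <= 1 - (2 `^ (d%:R * p) + 1) / 2 `^ (d%:R * p + 1)
  then `|Num.ceil (2 `^ (d%:R * p) : R)|%N
  else `|Num.floor (2 `^ (d%:R * p) : R)|%N.

Definition dyadic_cell p d P (j : 'I_n -> 'I_(2 ^ d))
    (m : 'I_(time_parts p d (truncation P))) : set ('rV[R]_n * R) :=
  let hx := l_x P / 2 ^+ d in
  let ht := l_t p P / (time_parts p d (truncation P))%:R in
  let x0 i := ctr_x P ord0 i - l_x P / 2 in
  let t0 := t_top P - l_x P `^ p in
  [set y : 'rV[R]_n | forall i,
     x0 i + (j i)%:R * hx <= y ord0 i < x0 i + (j i).+1%:R * hx]
  `*` [set s | t0 + m%:R * ht <= s < t0 + m.+1%:R * ht].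

Definition dyadic1 p d P : set (prect R n) :=
  [set Q | parabolic Q /\ exists j m, prect_set p Q = @dyadic_cell p d P j m].

Fixpoint dyadic_gen p d (i : nat) P : set (prect R n) :=
  match i with
  | 0 => [set P]
  | i'.+1 => \bigcup_(Q in dyadic_gen p d i' P) dyadic1 p d Q
  end.

Definition dyadic p d P : set (prect R n) :=
  \bigcup_(i in [set: nat]) dyadic_gen p d i P.

Definition E_free p E P : Prop := prect_set p P `&` E = set0.

Definition maximal_free p d E P : set (prect R n) :=
  [set Q | [/\ dyadic p d P Q, E_free p E Q &
    forall Q', dyadic p d P Q' -> E_free p E Q' ->
      prect_set p Q `<=` prect_set p Q' -> prect_set p Q' = prect_set p Q]].

(* The set M(P), i.e. [prect_set p Q] for some Q in [maximal_free p d E P] with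
   largest [l_x], and set0 if there is none. *)
Definition largest_free p d E P : set ('rV[R]_n * R) :=
  xget set0 [set prect_set p Q | Q in [set Q | maximal_free p d E P Q /\
    forall Q', maximal_free p d E P Q' -> l_x Q' <= l_x Q]].

Definition weakly_porous p d E c delta theta : Prop :=
  let mu := lebesgue_spacetime R n in
  forall P, parabolic P ->
  exists N (S : 'I_N -> prect R n),
  [/\ forall k, dyadic p d P (S k) /\ E_free p E (S k),
      trivIset setT (fun k => prect_set p (S k)),
      forall k, (delta%:E * mu (largest_free p d E (time_shift p theta P))
                 <= mu (prect_set p (S k)))%E &
      (c%:E * mu (prect_set p P) <= \sum_(k < N) mu (prect_set p (S k)))%E].

End rectangles.

Section A1.
Variables (R : realType) (n : nat).
Implicit Types (p gamma : R) (w : 'rV[R]_n * R -> \bar R).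
Let mu := lebesgue_spacetime R n.

Definition Rminus p (x : 'rV[R]_n) (t L gamma : R) : set ('rV[R]_n * R) :=
  spatial_cube x L `*` [set s | t - L `^ p < s < t - gamma * L `^ p].

Definition Rplus p (x : 'rV[R]_n) (t L gamma : R) : set ('rV[R]_n * R) :=
  spatial_cube x L `*` [set s | t + gamma * L `^ p < s < t + L `^ p].

(* Weights are extended-real valued: a negative power of the distance to E is
   +oo on E. *)
Definition L1loc w : Prop :=
  measurable_fun setT (w : 'rV[R]_n * measurableTypeR R -> \bar R) /\
  forall K : set ('rV[R]_n * R), compact K ->
    (\int[mu]_(z in K) `|w z| < +oo)%E.

(* The value +oo off D does not affect the infimum over D. *)
Definition ess_inf_on (D : set ('rV[R]_n * R)) w : \bar R :=
  ess_inf mu (patch (cst +oo%E) D w).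

Definition A1plus p gamma w : Prop :=
  [/\ forall z, (0 <= w z)%E, L1loc w &
  exists2 C : R, 0 < C & forall (x : 'rV[R]_n) (t L : R), 0 < L ->
    ((mu (Rminus p x t L gamma))^-1 * \int[mu]_(z in Rminus p x t L gamma) w z
     <= C%:E * ess_inf_on (Rplus p x t L gamma) w)%E].

(* dist_p(., E)^(-a) for a > 0; here [0%:E^-1 = +oo], whereas the library's
   real power has 0 `^ (- a) = 0. *)
Definition dist_weight p (E : set ('rV[R]_n * R)) (a : R)
    (z : 'rV[R]_n * R) : \bar R :=
  ((parabolic_setdist p E z `^ a)%:E^-1)%E.

End A1.

(* Main.v *)
Require Import Defs.
From mathcomp Require Import all_boot all_order all_algebra.
From mathcomp Require Import all_classical all_reals all_analysis.
From mathcomp Require Import measurable_realfun ess_sup_inf.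
From mathcomp Require Import ring lra.
Import Order.TTheory GRing.Theory Num.Theory.
Import numFieldNormedType.Exports.
Set Implicit Arguments.
Unset Strict Implicit.
Unset Printing Implicit Defensive.

Local Open Scope classical_set_scope.
Local Open Scope ring_scope.

(* Let w = dist_p(., E)^(-b) with b = alpha (n + p), let R be a rectangle and
   M a largest E-free dyadic rectangle of R^theta.  Around the centre of M one
   has w <= (l_x(M) / 8)^(-b).  Any small box in R is joined to the centre of M
   by N steps R^- -> R^+ of the A_1^+ condition, where N depends only on p,
   gamma and theta: steps of duration (1 + gamma) l^p can make up the spatial
   displacement, because l_x(R) / N is small against N^(-1/p) l_x(R) when p > 1
   and N is large.  Hence int_R w <= K |R| l_x(M)^(-b).

   A dyadic cell of side l that meets E lies at distance at most l from E, so
   the cells of one generation that are not E-free have total measure at most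
   l^b int_R w <= K |R| (l / l_x(M))^b.  With l^(n + p) comparable to
   2 delta |M| the free cells are admissible, and the remaining ones fill a
   proportion O(delta^alpha) of R.  If there is no M, local integrability of w
   makes the same argument work with l small. *)

(** * Lebesgue measure of boxes *)

Section measure_boxes.
Variables (R : realType) (n : nat).
Let mu := lebesgue_spacetime R n.

Lemma measurable_rV_box (J : 'I_n -> interval R) :
  measurable [set y : 'rV[R]_n | forall i, [set` J i] (y ord0 i)].
Proof.
rewrite (_ : [set _ | _] = \bigcap_(i in [set: 'I_n])
    ((fun y : 'rV[R]_n => y ord0 i) @^-1` [set` J i])).
  apply: fin_bigcap_measurable => // i _; rewrite -[X in measurable X]setTI.
  exact: measurable_coord.
by apply/seteqP; split => [y H i _ /=|y H i]; exact: H.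
Qed.

Lemma measurable_spatial_cube (x : 'rV[R]_n) (L : R) :
  measurable (spatial_cube x L).
Proof.
rewrite (_ : spatial_cube x L = [set y : 'rV[R]_n | forall i,
    [set` `[x ord0 i - L / 2, x ord0 i + L / 2[] (y ord0 i)]).
  exact: measurable_rV_box.
by apply/seteqP; split => y H i; have := H i; rewrite /= in_itv.
Qed.

Lemma lebesgue_spacetime_cubeX (x : 'rV[R]_n) (L : R) (J : set R) : 0 <= L ->
  measurable (J : set (measurableTypeR R)) ->
  mu (spatial_cube x L `*` J) = ((L ^+ n)%:E * @lebesgue_measure R J)%E.
Proof.
move=> L0 mJ; rewrite /mu /lebesgue_spacetime /=.
rewrite product_measure1E//; last exact: measurable_spatial_cube.
congr (_ * _)%E.
transitivity (@lebesgue_rV R n (spatial_cube x L)); first by [].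
have := @lebesgue_rV_box R n (\row_i (x ord0 i - L / 2)) (\row_i (x ord0 i + L / 2)).
rewrite (_ : [set _ | _] = spatial_cube x L); last first.
  by apply/seteqP; split => y H i; have := H i; rewrite !mxE.
move=> -> => [|i]; last by rewrite !mxE; lra.
congr _%:E; under eq_bigr do rewrite !mxE.
rewrite (eq_bigr (fun=> L)); last by move=> i _; field.
by rewrite prodr_const card_ord.
Qed.

Lemma lebesgue_spacetime_box (x : 'rV[R]_n) (L a b : R) (b1 b2 : bool) :
  0 <= L -> a <= b ->
  mu (spatial_cube x L `*` [set` Interval (BSide b1 a) (BSide b2 b)])
  = (L ^+ n * (b - a))%:E.
Proof.
move=> L0 ab; rewrite lebesgue_spacetime_cubeX//.
rewrite lebesgue_measure_itv/= lte_fin EFinM; congr (_ * _)%E.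
by case: ltgtP ab => // -> _; rewrite subrr.
Qed.

Lemma measurable_box (x : 'rV[R]_n) (L : R) (J : interval R) :
  measurable (spatial_cube x L `*` [set` J] : set ('rV[R]_n * measurableTypeR R)).
Proof. by apply: measurableX => //; exact: measurable_spatial_cube. Qed.

End measure_boxes.

(** * Chains of A_1^+ rectangles *)

(* R^-(y, t, l, gamma) and R^+(y, t, l, gamma) recentred at their midpoint. *)
Definition centered_box (R : realType) (n : nat) (p gamma : R)
    (y : 'rV[R]_n) (s l : R) : set ('rV[R]_n * R) :=
  spatial_cube y l `*` [set t | `|t - s| < (1 - gamma) / 2 * l `^ p].

Lemma centered_boxE (R : realType) (n : nat) (p gamma : R)
    (y : 'rV[R]_n) (s l : R) : centered_box p gamma y s l =
  spatial_cube y l `*`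
  [set` `]s - (1 - gamma) / 2 * l `^ p, s + (1 - gamma) / 2 * l `^ p[].
Proof.
rewrite /centered_box; congr (_ `*` _).
by apply/seteqP; split => t /=; rewrite in_itv/= ltr_norml => /andP[? ?];
  apply/andP; split; lra.
Qed.

Lemma measurable_centered_box (R : realType) (n : nat) (p gamma : R)
    (y : 'rV[R]_n) (s l : R) : measurable
  (centered_box p gamma y s l : set ('rV[R]_n * measurableTypeR R)).
Proof. by rewrite centered_boxE; exact: measurable_box. Qed.

Section chain.
Variables (R : realType) (n : nat) (p gamma C : R).
Variable w : 'rV[R]_n * R -> \bar R.
Let mu := lebesgue_spacetime R n.
Hypothesis gamma01 : 0 < gamma < 1.
Hypothesis C0 : 0 < C.
Hypothesis w0 : forall z, (0 <= w z)%E.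
Hypothesis mw : measurable_fun setT (w : 'rV[R]_n * measurableTypeR R -> \bar R).
Hypothesis wA1 : forall (x : 'rV[R]_n) (t L : R), 0 < L ->
  ((mu (Rminus p x t L gamma))^-1 * \int[mu]_(z in Rminus p x t L gamma) w z
   <= C%:E * ess_inf_on (Rplus p x t L gamma) w)%E.

Lemma ess_inf_on_ge0 (D : set ('rV[R]_n * R)) : (0 <= ess_inf_on D w)%E.
Proof.
rewrite /ess_inf_on; apply/ess_infP; apply: aeW => z.
by rewrite /patch; case: ifPn => //= _; exact: leey.
Qed.

(** On [D] the patched function is [w] itself, so its essential infimum is an almost everywhere
    lower bound for [w] on every measurable part of [D]. *)
Lemma ess_inf_on_le_integral (D A : set ('rV[R]_n * measurableTypeR R)) :
  measurable A -> A `<=` D ->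
  (ess_inf_on D w * mu A <= \int[mu]_(z in A) w z)%E.
Proof.
move=> mA AD; rewrite -integral_cst//.
apply: ae_ge0_le_integral => //.
- by move=> z _; exact: ess_inf_on_ge0.
- exact: measurable_funTS.
have := ess_inf_le mu (patch (cst +oo%E) D w).
apply: filterS => z /= + Az; rewrite /patch mem_set //; last exact: AD.
Qed.

(** The common measure of R^- and R^+ of spatial side [l]. *)
Let V (l : R) := l ^+ n * ((1 - gamma) * l `^ p).

Let V_gt0 l : 0 < l -> 0 < V l.
Proof.
move=> l0; rewrite /V mulr_gt0 ?exprn_gt0// mulr_gt0 ?powR_gt0//.
by case/andP: gamma01; lra.
Qed.

Let RminusE (x : 'rV[R]_n) (t l : R) : Rminus p x t l gamma =
  spatial_cube x l `*` [set` `]t - l `^ p, t - gamma * l `^ p[].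
Proof. by apply/seteqP; split => -[y s] /= []; rewrite in_itv/= => ? ?. Qed.

Let RplusE (x : 'rV[R]_n) (t l : R) : Rplus p x t l gamma =
  spatial_cube x l `*` [set` `]t + gamma * l `^ p, t + l `^ p[].
Proof. by apply/seteqP; split => -[y s] /= []; rewrite in_itv/= => ? ?. Qed.

Let mu_Rminus (x : 'rV[R]_n) (t l : R) : 0 < l ->
  mu (Rminus p x t l gamma) = (V l)%:E.
Proof.
move=> l0; rewrite RminusE lebesgue_spacetime_box ?ltW//.
  by congr _%:E; rewrite /V; ring.
have := powR_gt0 p l0; case/andP: gamma01 => *; nra.
Qed.

(** The essential infimum over R^+ is at most the average of [w] over any part [A] of R^+ with
    positive measure. Replacing it by that average turns the A_1^+ condition into a comparison of
    two integrals, which can be iterated. *)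
Lemma integral_Rminus_le (x : 'rV[R]_n) (t l : R)
    (A : set ('rV[R]_n * measurableTypeR R)) (a : R) :
  0 < l -> measurable A -> A `<=` Rplus p x t l gamma -> mu A = a%:E -> 0 < a ->
  (\int[mu]_(z in Rminus p x t l gamma) w z <=
   (C * V l / a)%:E * \int[mu]_(z in A) w z)%E.
Proof.
move=> l0 mA AR muA a0; have := wA1 x t l0.
rewrite mu_Rminus// inver gt_eqF ?V_gt0// lee_pdivrMl ?V_gt0// => /le_trans.
apply; have := ess_inf_on_le_integral mA AR.
rewrite muA -lee_pdivlMr// => ea.
rewrite muleA -EFinM (mulrC (V l)).
have CV : 0 < C * V l by rewrite mulr_gt0// V_gt0.
apply: le_trans (lee_wpmul2l _ ea) _; first by rewrite lee_fin ltW.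
by rewrite muleCA muleC EFinM.
Qed.

Let itv_eq (a b a' b' : R) :
  a = a' -> b = b' -> [set` `]a, b[] = [set` `]a', b'[].
Proof. by move=> -> ->. Qed.

Let cbox := (@centered_box R n p gamma).

(** R^- has its time midpoint (1 + gamma) / 2 * l^p before the reference time, and R^+ has it as far
    after. One passage from R^- to R^+ thus moves the midpoint by (1 + gamma) l^p. *)
Let cboxE y s l : cbox y s l = Rminus p y (s + (1 + gamma) / 2 * l `^ p) l gamma.
Proof.
by rewrite RminusE /cbox centered_boxE; congr (_ `*` _); apply: itv_eq; field.
Qed.

Let cbox_Rplus y s l : cbox y (s + (1 + gamma) * l `^ p) l =
  Rplus p y (s + (1 + gamma) / 2 * l `^ p) l gamma.
Proof.
by rewrite RplusE /cbox centered_boxE; congr (_ `*` _); apply: itv_eq; field.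
Qed.

(** The cubes of side [l] about [y] and [y + v] share the cube of side [l / 2] about [y + v / 2].
    The common part [A] has the fraction 2^-n of the measure of R^+, whence the factor
    [C * 2 ^+ n]. *)
Let cbox_step y s l (v : 'rV[R]_n) : 0 < l -> (forall i, `|v ord0 i| <= l / 2) ->
  (\int[mu]_(z in cbox y s l) w z <= (C * 2 ^+ n)%:E *
   \int[mu]_(z in cbox (y + v) (s + (1 + gamma) * l `^ p) l) w z)%E.
Proof.
move=> l0 vl; set s' := s + _.
pose A : set ('rV[R]_n * R) := spatial_cube (y + 2^-1 *: v) (l / 2) `*`
  [set` `]s' - (1 - gamma) / 2 * l `^ p, s' + (1 - gamma) / 2 * l `^ p[].
have mA : measurable (A : set ('rV[R]_n * measurableTypeR R)).
  exact: measurable_box.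
have muA : mu A = (V l / 2 ^+ n)%:E.
  rewrite lebesgue_spacetime_box; last 2 first.
  - lra.
  - by have := powR_gt0 p l0; case/andP: gamma01 => *; nra.
  by congr _%:E; rewrite /V expr_div_n; field; rewrite expf_neq0.
have V0 := V_gt0 l0.
have A1 : A `<=` Rplus p y (s + (1 + gamma) / 2 * l `^ p) l gamma.
  rewrite -cbox_Rplus /cbox centered_boxE => -[x t] [] /= xA ts'; split => //= i.
  have := xA i; have := vl i; rewrite !mxE ler_norml => /andP[? ?] /andP[? ?].
  by apply/andP; split; lra.
have A2 : A `<=` cbox (y + v) s' l.
  rewrite /cbox centered_boxE.
  move=> -[x t] [] /= xA ts'; split => //= i.
  have := xA i; have := vl i; rewrite !mxE ler_norml => /andP[? ?] /andP[? ?].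
  by apply/andP; split; lra.
rewrite cboxE; apply: (le_trans (integral_Rminus_le l0 mA A1 muA _)).
  by rewrite divr_gt0// exprn_gt0.
have -> : C * V l / (V l / 2 ^+ n) = C * 2 ^+ n.
  by field; rewrite expf_neq0//= gt_eqF.
apply: lee_wpmul2l; first by rewrite lee_fin mulr_ge0 ?ltW// exprn_gt0.
apply: ge0_subset_integral => //; first exact: measurable_centered_box.
exact: measurable_funTS.
Qed.

Let cbox_chain y s l (v : 'rV[R]_n) (k : nat) :
  0 < l -> (forall i, `|v ord0 i| <= l / 2) ->
  (\int[mu]_(z in cbox y s l) w z <= ((C * 2 ^+ n) ^+ k)%:E *
   \int[mu]_(z in cbox (y + k%:R *: v) (s + k%:R * ((1 + gamma) * l `^ p)) l) w z)%E.
Proof.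
move=> l0 vl; elim: k => [|k IH].
  by rewrite expr0 mul1e scale0r addr0 mul0r addr0.
apply: (le_trans IH); rewrite exprSr EFinM -muleA; apply: lee_wpmul2l.
  by rewrite lee_fin exprn_ge0// mulr_ge0 ?ltW// exprn_gt0.
rewrite -[k.+1%:R]natr1 scalerDl scale1r [(_ + 1) * _]mulrDl mul1r !addrA.
exact: cbox_step.
Qed.

(* [k] steps of displacement [v] in space and [(1 + gamma) l^p] in time, the
   latter being the distance between the centres of R^- and R^+; the last step
   lands in [A]. *)
Lemma integral_chain_le y s l (v : 'rV[R]_n) (k : nat) (b : R)
    (A : set ('rV[R]_n * measurableTypeR R)) :
  0 < l -> (forall i, `|v ord0 i| <= l / 2) ->
  measurable A -> (0 < mu A < +oo)%E -> 0 <= b ->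
  A `<=` 
    centered_box p gamma (y + k%:R *: v) (s + k.+1%:R * ((1 + gamma) * l `^ p)) l ->
  (forall z, A z -> (w z <= b%:E)%E) ->
  (\int[mu]_(z in centered_box p gamma y s l) w z <=
   ((C * 2 ^+ n) ^+ k * (C * (l ^+ n * l `^ p) * b))%:E)%E.
Proof.
move=> l0 vl mA /andP[A0 Aoo] b0 AD wb.
apply: le_trans (cbox_chain y s k l0 vl) _; rewrite EFinM.
apply: lee_wpmul2l.
  by rewrite lee_fin exprn_ge0// mulr_ge0 ?ltW// exprn_gt0.
have [a muA] : exists a, mu A = a%:E.
  by exists (fine (mu A)); rewrite fineK// ge0_fin_numE// ltW.
have a0 : 0 < a by rewrite -lte_fin -muA.
(* The last step moves in time only, so there are [k.+1] displacements in time against [k] in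
   space. *)
rewrite -/cbox cboxE; apply: le_trans (integral_Rminus_le l0 mA _ muA a0) _.
  rewrite -cbox_Rplus; move: AD; rewrite -[k.+1%:R]natr1 [(_ + 1) * _]mulrDl mul1r addrA; exact.
(* The measure [a] of [A] will cancel against the division by [a] in the previous bound, so the
   estimate does not depend on how small [A] is. *)
have J : (\int[mu]_(z in A) w z <= b%:E * a%:E)%E.
  rewrite -muA -integral_cst//; apply: ge0_le_integral => //.
  exact: measurable_funTS.
have V0 := V_gt0 l0.
apply: le_trans (lee_wpmul2l _ J) _.
  by rewrite lee_fin ltW// divr_gt0// mulr_gt0.
rewrite -!EFinM lee_fin.
have -> : C * V l / a * (b * a) = C * b * V l by field; rewrite gt_eqF.
have -> : C * (l ^+ n * l `^ p) * b = C * b * (l ^+ n * l `^ p) by ring.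
rewrite /V ler_wpM2l ?mulr_ge0 ?(ltW C0)// ler_wpM2l ?exprn_ge0 ?(ltW l0)//.
by have := powR_gt0 p l0; case/andP: gamma01 => *; nra.
Qed.

End chain.

(** * Dyadic partitions *)

Section tiles.
Variable R : realType.
Implicit Types (a h u : R) (N : nat).

Lemma tile_ex a h u N : 0 < h -> a <= u < a + N%:R * h ->
  exists j : 'I_N, a + j%:R * h <= u < a + j.+1%:R * h.
Proof.
move=> h0 /andP[au uN].
have v0 : 0 <= (u - a) / h by rewrite divr_ge0 ?(ltW h0)// subr_ge0.
have jN : (Num.truncn ((u - a) / h) < N)%N.
  by rewrite truncn_lt_nat// ltr_pdivrMr//; lra.
exists (Ordinal jN) => /=; have /andP[j1 j2] := truncn_itv v0.
apply/andP; split.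
  by move: j1; rewrite ler_pdivlMr//; lra.
by move: j2; rewrite ltr_pdivrMr//; lra.
Qed.

Lemma tile_uniq a h u (j k : nat) : 0 < h ->
  a + j%:R * h <= u < a + j.+1%:R * h -> a + k%:R * h <= u < a + k.+1%:R * h ->
  j = k.
Proof.
move=> h0 ju ku.
have H (i : nat) : a + i%:R * h <= u < a + i.+1%:R * h ->
    Num.truncn ((u - a) / h) = i.
  move=> /andP[i1 i2]; apply: truncn_def.
  by rewrite ler_pdivlMr// ltr_pdivrMr//; apply/andP; split; lra.
by rewrite -(H j)// (H k).
Qed.

Lemma tile_sub a h u N (j : 'I_N) : 0 < h ->
  a + j%:R * h <= u < a + j.+1%:R * h -> a <= u < a + N%:R * h.
Proof.
move=> h0 /andP[u1 u2]; apply/andP; split.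
  by apply: le_trans u1; rewrite lerDl mulr_ge0// ltW.
apply: lt_le_trans u2 _; rewrite lerD2l ler_pM2r// ler_nat.
exact: ltn_ord.
Qed.

End tiles.

Section dyadic.
Variables (R : realType) (n d : nat) (p : R).
Hypothesis dp9 : ln 9 / ln 2 <= d%:R * p.
Implicit Types P Q : prect R n.
Let mu := lebesgue_spacetime R n.

Lemma prect_setE P : prect_set p P = spatial_cube (ctr_x P) (l_x P) `*`
  [set` `[t_top P - l_x P `^ p, t_top P - truncation P * l_x P `^ p[].
Proof. by apply/seteqP; split => -[y s] /= []; rewrite /= in_itv. Qed.

Lemma measurable_prect P :
  measurable (prect_set p P : set ('rV[R]_n * measurableTypeR R)).
Proof. by rewrite prect_setE; exact: measurable_box. Qed.

Lemma l_t_bounds P : parabolic P ->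
  l_x P `^ p / 2 <= l_t p P <= l_x P `^ p.
Proof.
move=> [l0 /andP[? ?]]; rewrite /l_t; have := powR_gt0 p l0.
by move=> ?; apply/andP; split; nra.
Qed.

Lemma l_t_gt0 P : parabolic P -> 0 < l_t p P.
Proof.
move=> pP; have /andP[+ _] := l_t_bounds pP; have := powR_gt0 p pP.1; lra.
Qed.

Lemma lebesgue_prect P : parabolic P ->
  mu (prect_set p P) = (l_x P ^+ n * l_t p P)%:E.
Proof.
move=> pP; rewrite prect_setE lebesgue_spacetime_box ?(ltW pP.1)//.
  by congr _%:E; rewrite /l_t; ring.
by have := l_t_gt0 pP; rewrite /l_t; lra.
Qed.

Lemma lebesgue_prect_bounds P : parabolic P ->
  (((l_x P ^+ n * l_x P `^ p) / 2)%:E <= mu (prect_set p P)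
     <= (l_x P ^+ n * l_x P `^ p)%:E)%E.
Proof.
move=> pP; rewrite lebesgue_prect// !lee_fin -mulrA.
have /andP[? ?] := l_t_bounds pP.
by rewrite !ler_wpM2l// exprn_ge0// ltW//; case: pP.
Qed.

Lemma two_powR_ge9 : 9 <= 2 `^ (d%:R * p) :> R.
Proof.
have l2 : 0 < ln 2 :> R by rewrite ln_gt0// ltr1n.
rewrite -ler_ln ?posrE ?powR_gt0//.
by rewrite ln_powR -ler_pdivrMr.
Qed.

(** With K = 2^(dp), the quotient is 1 minus the truncation parameter of a dyadic child, so its
    bounds make the child parabolic. The threshold in [time_parts] means (1 - g) K >= (K + 1) / 2:
    then rounding K up keeps the quotient at least 1/2. Past the threshold, rounding K down keeps it
    at most 1. *)
Lemma time_parts_bounds (g : R) : 0 <= g <= 1 / 2 ->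
  1 / 2 <= (1 - g) * 2 `^ (d%:R * p) / (time_parts p d g)%:R <= 1
  /\ (0 < time_parts p d g)%N.
Proof.
move=> /andP[g0 g1]; have K9 := two_powR_ge9.
rewrite /time_parts powRD; last by rewrite pnatr_eq0 implybT.
rewrite powRr1//; set K := 2 `^ _ in K9 *.
have natE (z : int) : 0 <= z%:~R :> R -> (`|z|%N)%:R = z%:~R :> R.
  by rewrite ler0z => z0; rewrite -[in RHS](gez0_abs z0).
case: ifPn => [gK|].
  have c1 : K <= (Num.ceil K)%:~R by exact: ceil_ge.
  have c2 : (Num.ceil K)%:~R < K + 1 by have := ceilB1_lt K; rewrite intrB; lra.
  have cE := natE (Num.ceil K) ltac:(lra).
  split; last by rewrite -(ltr_nat R) cE; lra.
  rewrite cE; set c : R := (Num.ceil K)%:~R in c1 c2 *.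
  rewrite ler_pdivlMr ?ler_pdivrMr; [|lra..].
  have : (K + 1) / 2 <= (1 - g) * K.
    have -> : (K + 1) / 2 = (1 - (1 - (K + 1) / (K * 2))) * K by field; lra.
    by rewrite ler_wpM2r; lra.
  by move=> ?; apply/andP; split; nra.
rewrite -ltNge => gK.
have c1 : (Num.floor K)%:~R <= K by exact: floor_le.
have c2 : K < (Num.floor K)%:~R + 1 by have := floorD1_gt K; rewrite intrD; lra.
have cE := natE (Num.floor K) ltac:(lra).
split; last by rewrite -(ltr_nat R) cE; lra.
rewrite cE; set c : R := (Num.floor K)%:~R in c1 c2 *.
rewrite ler_pdivlMr ?ler_pdivrMr; [|lra..].
have : (1 - g) * K <= (K + 1) / 2.
  have -> : (K + 1) / 2 = (1 - (1 - (K + 1) / (K * 2))) * K by field; lra.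
  by rewrite ler_wpM2r; lra.
by move=> ?; apply/andP; split; nra.
Qed.

Definition dyadic_child P (j : 'I_n -> 'I_(2 ^ d))
    (m : 'I_(time_parts p d (truncation P))) : prect R n :=
  let hx := l_x P / 2 ^+ d in
  let ht := l_t p P / (time_parts p d (truncation P))%:R in
  Prect (\row_i (ctr_x P ord0 i - l_x P / 2 + ((j i)%:R + 1 / 2) * hx))
    (t_top P - l_x P `^ p + m%:R * ht + hx `^ p) hx (1 - ht / hx `^ p).

Lemma dyadic_child_cell P j m : parabolic P ->
  parabolic (@dyadic_child P j m) /\
  prect_set p (@dyadic_child P j m) = @dyadic_cell R n p d P j m.
Proof.
move=> pP; have [l0 g01] := pP.
have [/andP[k1 k2] k0] := time_parts_bounds g01.
have d0 : 0 < 2 ^+ d :> R by rewrite exprn_gt0.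
have hx0 : 0 < l_x P / 2 ^+ d by rewrite divr_gt0.
have hp0 := powR_gt0 p hx0.
split.
  split => //=.
  suff -> : l_t p P / (time_parts p d (truncation P))%:R / (l_x P / 2 ^+ d) `^ p
     = (1 - truncation P) * 2 `^ (d%:R * p) / (time_parts p d (truncation P))%:R.
    by apply/andP; split; lra.
  rewrite powRM ?ltW ?invr_gt0// /l_t.
  have -> : (2 ^+ d)^-1 `^ p = (2 `^ (d%:R * p))^-1 :> R.
    by rewrite powRrM powR_mulrn// -powR_inv1 ?ltW// powRAC powR_inv1 ?powR_ge0.
  have := powR_gt0 p l0 => lp; have K9 := two_powR_ge9.
  field; rewrite !gt_eqF//= ?ltr0n//; lra.
rewrite /prect_set /dyadic_cell /dyadic_child /=; congr (_ `*` _).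
  apply/seteqP; split => y /= H i; have := H i;
    rewrite !mxE -[(j i).+1%:R]natr1 => /andP[? ?]; by apply/andP; split; lra.
have e : (1 - l_t p P / (time_parts p d (truncation P))%:R / (l_x P / 2 ^+ d) `^ p)
   * (l_x P / 2 ^+ d) `^ p = (l_x P / 2 ^+ d) `^ p - l_t p P / (time_parts p d (truncation P))%:R.
  by field; rewrite !gt_eqF//= ltr0n.
apply/seteqP; split => s /=; rewrite e -[m.+1%:R]natr1 => /andP[? ?];
  by apply/andP; split; lra.
Qed.

Let x_end P i : ctr_x P ord0 i - l_x P / 2 + (2 ^ d)%:R * (l_x P / 2 ^+ d)
  = ctr_x P ord0 i + l_x P / 2.
Proof. by rewrite natrX; field; rewrite expf_neq0. Qed.

Let t_end P : parabolic P -> t_top P - l_x P `^ p +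
  (time_parts p d (truncation P))%:R *
    (l_t p P / (time_parts p d (truncation P))%:R)
  = t_top P - truncation P * l_x P `^ p.
Proof.
move=> [_ /time_parts_bounds[_ k0]].
by rewrite /l_t; field; rewrite gt_eqF// ltr0n.
Qed.

Let hx_gt0 P : parabolic P -> 0 < l_x P / 2 ^+ d.
Proof. by move=> [l0 _]; rewrite divr_gt0// exprn_gt0. Qed.

Let ht_gt0 P : parabolic P ->
  0 < l_t p P / (time_parts p d (truncation P))%:R.
Proof.
move=> pP; have [_ /time_parts_bounds[_ k0]] := pP.
by rewrite divr_gt0 ?l_t_gt0// ltr0n.
Qed.

Lemma dyadic_cell_sub P j m : parabolic P ->
  @dyadic_cell R n p d P j m `<=` prect_set p P.
Proof.
move=> pP -[y s] [/= yj sm]; split => /=.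
  by move=> i; have := tile_sub (hx_gt0 pP) (yj i); rewrite x_end.
by have := tile_sub (ht_gt0 pP) sm; rewrite t_end.
Qed.

Lemma dyadic1_partition P : parabolic P ->
  exists (T : finType) (S : T -> prect R n),
  [/\ forall k, [/\ dyadic1 p d P (S k), parabolic (S k) &
        l_x (S k) = l_x P / 2 ^+ d],
      trivIset setT (fun k => prect_set p (S k)) &
      \bigcup_k prect_set p (S k) = prect_set p P].
Proof.
move=> pP.
have cE j m := (@dyadic_child_cell P j m pP).2.
exists ({ffun 'I_n -> 'I_(2 ^ d)} * 'I_(time_parts p d (truncation P)))%type.
exists (fun k : {ffun 'I_n -> 'I_(2 ^ d)} * 'I_(time_parts p d (truncation P)) =>
  @dyadic_child P k.1 k.2); split.
- move=> [j m] /=; have [c1 c2] := @dyadic_child_cell P j m pP.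
  by split => //; split => //; exists j, m.
- move=> [j m] [j' m'] _ _ /= [[y s]]; rewrite !cE => -[[/= yj sm] [/= yj' sm']].
  congr (_, _); last by apply/val_inj; exact: tile_uniq (ht_gt0 pP) sm sm'.
  by apply/ffunP => i; apply/val_inj; exact: tile_uniq (hx_gt0 pP) (yj i) (yj' i).
apply/seteqP; split => -[y s].
  move=> [[j m] _ /=]; rewrite cE; exact: dyadic_cell_sub.
move=> [/= yP sP].
have /choice[j yj] i : exists k : 'I_(2 ^ d),
    ctr_x P ord0 i - l_x P / 2 + k%:R * (l_x P / 2 ^+ d) <= y ord0 i <
    ctr_x P ord0 i - l_x P / 2 + k.+1%:R * (l_x P / 2 ^+ d).
  by apply: tile_ex (hx_gt0 pP) _; rewrite x_end.
have [m sm] : exists m : 'I_(time_parts p d (truncation P)),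
   t_top P - l_x P `^ p + m%:R * (l_t p P / (time_parts p d (truncation P))%:R)
   <= s < t_top P - l_x P `^ p + m.+1%:R * (l_t p P / (time_parts p d (truncation P))%:R).
  by apply: tile_ex (ht_gt0 pP) _; rewrite t_end.
exists ([ffun i => j i], m) => //=; rewrite cE; split => //= i.
by rewrite ffunE.
Qed.

Lemma dyadic_gen_partition P i : parabolic P ->
  exists (T : finType) (S : T -> prect R n),
  [/\ forall k, [/\ dyadic_gen p d i P (S k), parabolic (S k) &
        l_x (S k) = l_x P / 2 ^+ (d * i)],
      trivIset setT (fun k => prect_set p (S k)) &
      \bigcup_k prect_set p (S k) = prect_set p P].
Proof.
move=> pP; elim: i => [|i [T [S [S1 S2 S3]]]].
  exists unit, (fun=> P); split.
  - by move=> ?; split => //; rewrite muln0 expr0 divr1.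
  - by move=> [] [].
  - by apply/seteqP; split => [z [] //|z zP]; exists tt.
(* The index type of the children depends on the parent [S k], so the next generation is indexed by
   a sigma type of pairs of a parent and a child. *)
have H k : {T' : finType & {S' : T' -> prect R n |
  [/\ forall k', [/\ dyadic1 p d (S k) (S' k'), parabolic (S' k') &
        l_x (S' k') = l_x (S k) / 2 ^+ d],
      trivIset setT (fun k => prect_set p (S' k)) &
      \bigcup_k prect_set p (S' k) = prect_set p (S k)]}}.
  have [_ pk _] := S1 k.
  have /cid[T' /cid[S' H]] := dyadic1_partition pk.
  by exists T', S'.
pose T' k := projT1 (H k); pose S' k := proj1_sig (projT2 (H k)).
have HS k : [/\ forall k', [/\ dyadic1 p d (S k) (S' k k'), parabolic (S' k k') &
        l_x (S' k k') = l_x (S k) / 2 ^+ d],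
      trivIset setT (fun k' => prect_set p (S' k k')) &
      \bigcup_k' prect_set p (S' k k') = prect_set p (S k)].
  exact: proj2_sig (projT2 (H k)).
exists {k : T & T' k}, (fun k : {k : T & T' k} => S' (tag k) (tagged k)); split.
- move=> [k k'] /=; have [/(_ k')[a1 a2 a3] _ _] := HS k.
  have [b1 b2 b3] := S1 k.
  split => //; first by exists (S k).
  by rewrite a3 b3 mulnS addnC exprD invfM mulrA.
- move=> [k k'] [j j'] _ _ /= [z [zk zj]].
  have [_ _ Hk] := HS k; have [_ _ Hj] := HS j.
  have e : k = j.
    apply: S2 => //; exists z; split.
    - by rewrite -Hk; exists k'.
    - by rewrite -Hj; exists j'.
  subst j; congr (existT _ _ _); have [_ t _] := HS k.
  by apply: t => //; exists z.
- rewrite -S3; apply/seteqP; split => z.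
    move=> [[k k'] _ zk]; exists k => //.
    by have [_ _ <-] := HS k; exists k'.
  move=> [k _]; have [_ _ <-] := HS k => -[k' _ zk].
  by exists (existT _ k k').
Qed.

Lemma dyadic_sub P Q : parabolic P -> dyadic p d P Q ->
  parabolic Q /\ prect_set p Q `<=` prect_set p P.
Proof.
move=> pP [i _]; elim: i Q => [|i IH] Q /=; first by move=> ->; split.
move=> [Q' /IH[pQ' sQ']] [pQ [j [m QE]]]; split => //.
apply: subset_trans sQ'; rewrite QE.
exact: dyadic_cell_sub.
Qed.

End dyadic.

(** * The parabolic distance *)

Section distance.
Variables (R : realType) (n : nat) (p : R) (E : set ('rV[R]_n * R)).
Hypothesis p1 : 1 < p.
Implicit Types (P Q : prect R n) (z e : 'rV[R]_n * R).

Lemma rV_norm_coord (x : 'rV[R]_n) i : `|x ord0 i| <= `|x|.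
Proof.
rewrite [leRHS]mx_normrE.
exact: (le_bigmax _ (fun i : 'I_1 * 'I_n => `|x i.1 i.2|) (ord0, i)).
Qed.

Lemma rV_norm_le (x : 'rV[R]_n) b : 0 <= b ->
  (forall i, `|x ord0 i| <= b) -> `|x| <= b.
Proof.
move=> b0 xb; rewrite [leLHS]mx_normrE; apply: bigmax_le => // -[i j] _ /=.
by rewrite ord1.
Qed.

Lemma parabolic_dist_ge0 z e : 0 <= parabolic_dist p z e.
Proof. by rewrite /parabolic_dist le_max normr_ge0. Qed.

Lemma parabolic_setdist_ge0 z : E !=set0 -> 0 <= parabolic_setdist p E z.
Proof.
move=> [e Ee]; apply: lb_le_inf; first by exists (parabolic_dist p z e), e.
by move=> _ [e' _ <-]; exact: parabolic_dist_ge0.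
Qed.

Lemma parabolic_setdist_le z e : E e ->
  parabolic_setdist p E z <= parabolic_dist p z e.
Proof.
move=> Ee; apply: ge_inf; last by exists e.
by exists 0 => _ [e' _ <-]; exact: parabolic_dist_ge0.
Qed.

Lemma parabolic_setdist_ge z b : E !=set0 ->
  (forall e, E e -> b <= parabolic_dist p z e) -> b <= parabolic_setdist p E z.
Proof.
move=> [e Ee] Eb; apply: lb_le_inf; first by exists (parabolic_dist p z e), e.
by move=> _ [e' Ee' <-]; exact: Eb.
Qed.

Lemma prect_dist_le P z e : parabolic P -> prect_set p P z -> prect_set p P e ->
  parabolic_dist p z e <= l_x P.
Proof.
move=> pP [/= zx /andP[zt1 zt2]] [/= ex /andP[et1 et2]]; have [l0 g01] := pP.
rewrite /parabolic_dist ge_max; apply/andP; split.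
  apply: rV_norm_le => [|i]; first exact: ltW.
  rewrite !mxE ler_norml; have := zx i; have := ex i.
  by move=> /andP[? ?] /andP[? ?]; apply/andP; split; lra.
have p0 : 0 < p := lt_trans ltr01 p1.
rewrite -[leRHS]powRr1 ?(ltW l0)// -(divff (lt0r_neq0 p0)) powRrM.
apply: ge0_ler_powR; rewrite ?nnegrE ?invr_ge0 ?powR_ge0 ?(ltW p0)//.
case/andP: g01 => g0 _; have := mulr_ge0 g0 (powR_ge0 (l_x P) p).
by rewrite ler_norml => ?; apply/andP; split; lra.
Qed.

(** The concentric part with half the spatial side and half the duration. In an [E]-free rectangle
    it stays away from [E] by a fixed fraction of the side. *)
Definition prect_core P : set ('rV[R]_n * R) :=
  spatial_cube (ctr_x P) (l_x P / 2) `*`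
  [set t | `|t - (t_top P - l_x P `^ p + l_t p P / 2)| < l_t p P / 4].

(** Leaving the rectangle from its core takes a spatial move of at least L / 4 or a time move of at
    least [l_t p P / 4]. Since p > 1 and the duration is at least L^p / 2, one has (L / 8)^p <= L^p
    / 8 <= [l_t p P / 4], so 1/8 serves both cases. *)
Lemma prect_core_dist P z e : parabolic P -> prect_core P z ->
  ~ prect_set p P e -> l_x P / 8 <= parabolic_dist p z e.
Proof.
move=> pP [/= zx zt] Pe; have [l0 g01] := pP.
rewrite leNgt; apply/negP; rewrite gt_max => /andP[dx dt]; apply: Pe.
split => /= [i|].
  have := zx i; have := rV_norm_coord (z.1 - e.1) i; rewrite !mxE => d1.
  have := le_lt_trans d1 dx; rewrite ltr_norml => /andP[? ?] /andP[? ?].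
  by apply/andP; split; lra.
have p0 : 0 < p := lt_trans ltr01 p1.
have : `|z.2 - e.2| < l_t p P / 4.
  apply: (@lt_le_trans _ _ ((l_x P / 8) `^ p)).
    have -> : `|z.2 - e.2| = (`|z.2 - e.2| `^ p^-1) `^ p.
      by rewrite -powRrM mulVf ?lt0r_neq0// powRr1.
    apply: gt0_ltr_powR => //; rewrite ?nnegrE ?powR_ge0//.
    by rewrite divr_ge0 ?(ltW l0)//.
  have : (l_x P / 8) `^ p <= l_x P `^ p / 8.
    rewrite mulrC [leRHS]mulrC; apply: ge1r_powRZ; rewrite ?(ltW l0) ?(ltW p1)//.
    by rewrite invr_gt0 invf_le1//; apply/andP; split; lra.
  have /andP[+ _] := l_t_bounds p pP; have := powR_gt0 p l0; lra.
move: zt; rewrite !ltr_norml /l_t => /andP[? ?] /andP[? ?].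
by apply/andP; split; lra.
Qed.

Lemma dist_weight_ge0 a z : (0 <= dist_weight p E a z)%E.
Proof. by rewrite /dist_weight inve_ge0 lee_fin powR_ge0. Qed.

Lemma dist_weight_ge a z b : E !=set0 -> 0 < a -> 0 < b ->
  parabolic_setdist p E z <= b -> ((b `^ a)^-1%:E <= dist_weight p E a z)%E.
Proof.
move=> E0 a0 b0 zb; rewrite /dist_weight.
have -> : (b `^ a)^-1%:E = ((b `^ a)%:E^-1)%E.
  by rewrite inver gt_eqF// powR_gt0.
rewrite lee_pV2 ?inE ?lee_fin ?powR_ge0//.
apply: ge0_ler_powR => //; rewrite ?nnegrE ?(ltW a0) ?(ltW b0)//.
exact: parabolic_setdist_ge0.
Qed.

Lemma dist_weight_le a z b : E !=set0 -> 0 < a -> 0 < b ->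
  b <= parabolic_setdist p E z -> (dist_weight p E a z <= (b `^ a)^-1%:E)%E.
Proof.
move=> E0 a0 b0 zb; rewrite /dist_weight.
have -> : (b `^ a)^-1%:E = ((b `^ a)%:E^-1)%E.
  by rewrite inver gt_eqF// powR_gt0.
rewrite lee_pV2 ?inE ?lee_fin ?powR_ge0//.
apply: ge0_ler_powR => //; rewrite ?nnegrE ?(ltW a0) ?(ltW b0)//.
exact: parabolic_setdist_ge0.
Qed.

Lemma dist_weight_core a P z : E !=set0 -> 0 < a -> parabolic P ->
  E_free p E P -> prect_core P z ->
  (dist_weight p E a z <= ((l_x P / 8) `^ a)^-1%:E)%E.
Proof.
move=> E0 a0 pP fP zP; apply: dist_weight_le => //.
  by rewrite divr_gt0//; case: pP.
apply: parabolic_setdist_ge => // e Ee; apply: prect_core_dist => // Pe.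
by have : (prect_set p P `&` E) e by []; rewrite fP.
Qed.

Lemma dist_weight_nonfree a P z : E !=set0 -> 0 < a -> parabolic P ->
  ~ E_free p E P -> prect_set p P z ->
  ((l_x P `^ a)^-1%:E <= dist_weight p E a z)%E.
Proof.
move=> E0 a0 pP /eqP/set0P[e [Pe Ee]] zP; apply: dist_weight_ge => //.
  by case: pP.
exact: le_trans (parabolic_setdist_le _ Ee) (prect_dist_le pP zP Pe).
Qed.

End distance.

(** * From a rectangle to a free rectangle in its future *)

Lemma ler_powRr (R : realType) (p x y : R) : 0 < p -> 0 <= x -> 0 <= y ->
  (x `^ p <= y `^ p) = (x <= y).
Proof.
move=> p0 x0 y0; have [xy|yx] := leP x y.
  by apply: ge0_ler_powR => //; rewrite ltW.
apply/negbTE; rewrite -ltNge; exact: gt0_ltr_powR.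
Qed.

Lemma powRK (R : realType) (p x : R) : 0 < p -> 0 <= x -> (x `^ p^-1) `^ p = x.
Proof. by move=> p0 x0; rewrite -powRrM mulVf ?lt0r_neq0// powRr1. Qed.

Lemma exists_nat_powR (R : realType) (q a b : R) : 0 < q -> 0 < a -> 0 <= b ->
  exists k : nat, b <= a * k.+1%:R `^ q.
Proof.
move=> q0 a0 b0; exists (Num.truncn ((b / a) `^ q^-1)).
rewrite -ler_pdivrMl// mulrC -[leLHS](powRK q0) ?divr_ge0 ?(ltW a0)//.
rewrite ler_powRr ?powR_ge0//; exact/ltW/truncnS_gt.
Qed.

Lemma exists_inv_pow_le (R : realType) (d : nat) (a : R) : (0 < d)%N -> 0 < a ->
  exists i, (2 ^+ (d * i))^-1 <= a.
Proof.
move=> d0 a0; exists (Num.truncn a^-1).+1.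
rewrite -[leRHS]invrK lef_pV2 ?posrE ?invr_gt0 ?exprn_gt0//.
apply: (le_trans (ltW (truncnS_gt _))); rewrite -natrX ler_nat.
apply: leq_trans (ltnW (ltn_expl _ (ltnSn 1))).
by rewrite leq_pmull.
Qed.

Section chain_to_free_rectangle.
Variables (R : realType) (n : nat) (p gamma C theta b : R).
Variable E : set ('rV[R]_n * R).
Let mu := lebesgue_spacetime R n.
Let w := dist_weight p E b.
Hypothesis gamma01 : 0 < gamma < 1.
Hypothesis p1 : 1 < p.
Hypothesis theta1 : 1 < theta.
Hypothesis b0 : 0 < b.
Hypothesis E0 : E !=set0.
Hypothesis C0 : 0 < C.
Hypothesis mw : measurable_fun setT (w : 'rV[R]_n * measurableTypeR R -> \bar R).
Hypothesis wA1 : forall (x : 'rV[R]_n) (t L : R), 0 < L ->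
  ((mu (Rminus p x t L gamma))^-1 * \int[mu]_(z in Rminus p x t L gamma) w z
   <= C%:E * ess_inf_on (Rplus p x t L gamma) w)%E.
Implicit Types (P M : prect R n) (z : 'rV[R]_n * R).

Let p0 : 0 < p. Proof. exact: lt_trans ltr01 p1. Qed.

Lemma prect_center P : parabolic P ->
  prect_set p P (ctr_x P, t_top P - l_x P `^ p + l_t p P / 2).
Proof.
move=> pP; have lt0 := l_t_gt0 p pP; split => /=.
  by move=> i; have := pP.1 => ?; apply/andP; split; lra.
by move: lt0; rewrite /l_t => ?; apply/andP; split; lra.
Qed.

(** Both rectangles last [l_t p P] and one starts [theta * l_t p P] after the other, so the time gap
    lies between theta - 1 and theta + 1 durations. As theta > 1, it is bounded below by a positive
    multiple of L^p. *)
Lemma time_shift_displacement P z z' : parabolic P ->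
  prect_set p P z -> prect_set p (time_shift p theta P) z' ->
  (forall i, `|z'.1 ord0 i - z.1 ord0 i| <= l_x P) /\
  (theta - 1) / 2 * l_x P `^ p <= z'.2 - z.2 <= (theta + 1) * l_x P `^ p.
Proof.
move=> pP [/= zx /andP[z1 z2]] [/= zx' /andP[z1' z2']]; split.
  move=> i; have := zx i; have := zx' i => /andP[? ?] /andP[? ?].
  by rewrite ler_norml; apply/andP; split; lra.
have /andP[l1 l2] := l_t_bounds p pP.
have t1 : (theta - 1) * (l_x P `^ p / 2) <= (theta - 1) * l_t p P.
  by rewrite ler_wpM2l// subr_ge0 ltW.
have t2 : (theta + 1) * l_t p P <= (theta + 1) * l_x P `^ p.
  by rewrite ler_wpM2l//; have := theta1; lra.
by move: t1 t2 z1' z2'; rewrite /l_t => *; apply/andP; split; lra.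
Qed.

(** The number of steps is fixed in advance and the side [l] is adapted to the time gap between [z]
    and the centre of [M]. Hence [K] and [kappa] are uniform, while [l] varies but stays above
    [kappa * l_x P]. *)
Lemma integral_box_le : exists K kappa : R, [/\ 0 < K, 0 < kappa &
  forall P M z, parabolic P -> parabolic M ->
  prect_set p M `<=` prect_set p (time_shift p theta P) -> E_free p E M ->
  prect_set p P z ->
  exists l, kappa * l_x P <= l /\
  (\int[mu]_(z in centered_box p gamma z.1 z.2 l) w z <=
   (K * (l_x P ^+ n * l_x P `^ p) * ((l_x M / 8) `^ b)^-1)%:E)%E].
Proof.
have [g0 g1] := andP gamma01.
(* With N steps, the gap bound (theta - 1) / 2 * L^p gives l^p >= (a / N) L^p. *)
pose a := (theta - 1) / (2 * (1 + gamma)).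
have a0 : 0 < a by rewrite /a divr_gt0 ?mulr_gt0//; have := theta1; lra.
(* The choice a N^(p - 1) >= 4^p, possible because p > 1, makes each spatial move at most
   [l / 4]. *)
have [k kP] := @exists_nat_powR R (p - 1) a (4 `^ p) ltac:(by rewrite subr_gt0)
  a0 (powR_ge0 _ _).
pose N : R := k.+1%:R.
have N1 : 1 <= N by rewrite ler1n.
have N0 : 0 < N by lra.
exists ((C * 2 ^+ n) ^+ k * C * (theta + 1) ^+ n.+1), ((a / N) `^ p^-1).
have th0 : 0 < theta + 1 by have := theta1; lra.
split.
- by rewrite !mulr_gt0// exprn_gt0// mulr_gt0// exprn_gt0.
- by rewrite powR_gt0// divr_gt0.
move=> P M [y s] pP pM MP fM zP.
have L0 := pP.1; have Lp0 := powR_gt0 p L0.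
set tc := t_top M - l_x M `^ p + l_t p M / 2.
have [/= dx /andP[T1 T2]] := time_shift_displacement pP zP (MP _ (prect_center pM)).
rewrite -/tc in T1 T2.
pose v : 'rV[R]_n := N^-1 *: (ctr_x M - y).
(* This side makes N steps of duration (1 + gamma) l^p fill the gap [tc - s] exactly. *)
pose l := ((tc - s) / (N * (1 + gamma))) `^ p^-1.
have T0 : 0 < tc - s.
  by apply: lt_le_trans T1; rewrite mulr_gt0// divr_gt0// subr_gt0.
have l0 : 0 < l by rewrite powR_gt0// divr_gt0// mulr_gt0//; lra.
have lp : l `^ p = (tc - s) / (N * (1 + gamma)).
  by rewrite powRK// divr_ge0 ?(ltW T0)// mulr_ge0//; lra.
clearbody l.
have lpN : N * ((1 + gamma) * l `^ p) = tc - s.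
  by rewrite lp; field; lra.
have alp : a / N * l_x P `^ p <= l `^ p.
  have -> : a / N * l_x P `^ p = ((theta - 1) / 2 * l_x P `^ p) / (N * (1 + gamma)).
    by rewrite /a; field; lra.
  by rewrite lp ler_wpM2r// invr_ge0 mulr_ge0; lra.
(* Each coordinate of [v] is at most L / N, and (4 L / N)^p = 4^p N^(-p) L^p <= (a / N) L^p <=
   l^p. *)
have vl i : `|v ord0 i| <= l / 4.
  rewrite !mxE normrM ger0_norm ?invr_ge0; last by lra.
  apply: (@le_trans _ _ (N^-1 * l_x P)); first by rewrite ler_wpM2l// invr_ge0; lra.
  rewrite ler_pdivlMr// mulrC.
  have Nl : 0 <= N^-1 * l_x P by rewrite mulr_ge0 ?invr_ge0 ?(ltW L0) ?(ltW N0).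
  rewrite -(ler_powRr p0) ?(ltW l0) ?mulr_ge0 ?invr_ge0 ?(ltW N0) ?(ltW L0)//.
  apply: le_trans alp; rewrite mulrA powRM ?(ltW L0)//; last by rewrite divr_ge0// ltW.
  rewrite ler_wpM2r ?(ltW Lp0)// powRM// ?invr_ge0 ?(ltW N0)//.
  have -> : N^-1 `^ p = (N * N `^ (p - 1))^-1.
    by rewrite mulr_powRB1 ?(ltW N0)// -powR_inv1 ?(ltW N0)// powRAC powR_inv1// powR_ge0.
  have Np0 := powR_gt0 (p - 1) N0.
  by rewrite invfM mulrCA mulrC ler_wpM2r ?invr_ge0 ?(ltW N0)// ler_pdivrMr.
exists l; split.
  rewrite -(ler_powRr p0) ?(ltW l0) ?mulr_ge0 ?powR_ge0 ?(ltW L0)//.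
  by rewrite powRM ?powR_ge0 ?(ltW L0)// powRK// divr_ge0 ?(ltW a0) ?(ltW N0).
(* [r] and [tau] make the target box [A] fit both in the core of [M], where the weight is bounded,
   and in the last box of the chain. *)
pose r := Num.min (l_x M / 2) (l / 2).
pose tau := Num.min (l_t p M / 4) ((1 - gamma) / 2 * l `^ p).
have r0 : 0 < r by rewrite lt_min !divr_gt0//; exact: pM.1.
have tau0 : 0 < tau.
  rewrite lt_min divr_gt0 ?(l_t_gt0 p pM)//=.
  by rewrite mulr_gt0 ?powR_gt0// divr_gt0// subr_gt0.
have [rM rl] : r <= l_x M / 2 /\ r <= l / 2.
  by split; rewrite ge_min lexx ?orbT.
have [tM tl] : tau <= l_t p M / 4 /\ tau <= (1 - gamma) / 2 * l `^ p.
  by split; rewrite ge_min lexx ?orbT.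
have vC : ctr_x M = y + N *: v by rewrite /v scalerA divff ?gt_eqF// scale1r subrKC.
clearbody r tau v.
pose A : set ('rV[R]_n * R) := spatial_cube (ctr_x M) r `*`
  [set` `]tc - tau, tc + tau[].
have Acore : A `<=` prect_core p M.
  move=> [x t] [/= xA]; rewrite in_itv /= => tA; split => /= [i|].
    by have := xA i => /andP[? ?]; apply/andP; split; lra.
  by move: tA; rewrite -/tc ltr_norml => /andP[? ?]; apply/andP; split; lra.
have Abox : A `<=`
    centered_box p gamma (y + k%:R *: v) (s + k.+1%:R * ((1 + gamma) * l `^ p)) l.
  (* Only [k] of the N = k + 1 steps move in space, so the chain ends at distance at most [l / 4]
     from the centre of [M]. The half side [r / 2 <= l / 4] of [A] still fits, which is why moves
     are kept below [l / 4]. *)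
  have -> : y + k%:R *: v = ctr_x M - v.
    by rewrite vC /N -[k.+1%:R]natr1 scalerDl scale1r addrA addrK.
  rewrite -/N lpN subrKC.
  move=> [x t] [/= xA]; rewrite in_itv /= => tA; split => /= [i|].
    have := xA i => /andP[? ?]; have := vl i; rewrite !mxE ler_norml => /andP[? ?].
    by apply/andP; split; lra.
  by move: tA; rewrite ltr_norml => /andP[? ?]; apply/andP; split; lra.
apply: le_trans (integral_chain_le (k := k) (b := ((l_x M / 8) `^ b)^-1) gamma01 C0
   (dist_weight_ge0 p E b) mw wA1 l0 _ _ _ _ Abox _) _.
- by move=> i; apply: le_trans (vl i) _; lra.
- exact: measurable_box.
- rewrite lebesgue_spacetime_box ?(ltW r0)//; last by lra.
  rewrite lte_fin ltry andbT mulr_gt0 ?exprn_gt0//; lra.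
- by rewrite invr_ge0 powR_ge0.
- by move=> z zA; apply: dist_weight_core => //; exact: Acore.
rewrite lee_fin.
have -> : forall x B : R, (C * 2 ^+ n) ^+ k * (C * x * B) = (C * 2 ^+ n) ^+ k * C * x * B.
  by move=> *; ring.
rewrite ler_wpM2r ?invr_ge0 ?powR_ge0// -[leRHS]mulrA ler_wpM2l//.
  by rewrite mulr_ge0 ?exprn_ge0 ?(ltW C0)// mulr_ge0 ?(ltW C0)// exprn_ge0.
have lpL : l `^ p <= (theta + 1) * l_x P `^ p.
  apply: le_trans T2; rewrite lp ler_pdivrMr ?mulr_gt0//; last by lra.
  by rewrite ler_peMr ?(ltW T0)//; nra.
have lL : l <= (theta + 1) * l_x P.
  rewrite -(ler_powRr p0) ?(ltW l0) ?mulr_ge0 ?(ltW th0) ?(ltW L0)//.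
  apply: (le_trans lpL); apply: le1r_powRZ; rewrite ?(ltW L0) ?(ltW p1)//.
  by have := theta1; lra.
have -> : (theta + 1) ^+ n.+1 * (l_x P ^+ n * l_x P `^ p) =
    ((theta + 1) * l_x P) ^+ n * ((theta + 1) * l_x P `^ p).
  by rewrite exprMn exprSr; ring.
apply: ler_pM; rewrite ?exprn_ge0 ?powR_ge0 ?(ltW l0)//.
by apply: lerXn2r; rewrite ?nnegrE ?(ltW l0) ?mulr_ge0 ?(ltW th0) ?(ltW L0).
Qed.

End chain_to_free_rectangle.

(** * Additivity of the integral and of the measure over a partition *)

Section partitions.
Variables (R : realType) (n : nat) (p : R) (P : prect R n).
Variables (T : finType) (S : T -> prect R n).
Let mu := lebesgue_spacetime R n.
Hypothesis S_disj : trivIset setT (fun k => prect_set p (S k)).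
Hypothesis S_cover : \bigcup_k prect_set p (S k) = prect_set p P.

Lemma integral_prect_partition (f : 'rV[R]_n * R -> \bar R) :
  (forall z, (0 <= f z)%E) ->
  measurable_fun setT (f : 'rV[R]_n * measurableTypeR R -> \bar R) ->
  (\int[mu]_(z in prect_set p P) f z =
   \sum_k \int[mu]_(z in prect_set p (S k)) f z)%E.
Proof.
move=> f0 mf; have sT : [set` index_enum T] = [set: T].
  by apply/seteqP; split => // x _ /=; rewrite mem_index_enum.
rewrite -S_cover -sT bigcup_seq ge0_integral_bigsetU //.
- by move=> k; exact: measurable_prect.
- exact: index_enum_uniq.
- by rewrite sT.
- exact: measurable_funTS.
Qed.

Lemma lebesgue_prect_partition :
  (mu (prect_set p P) = \sum_k mu (prect_set p (S k)))%E.
Proof.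
have H (Q : prect R n) :
    (\int[mu]_(z in prect_set p Q) cst 1%E z = mu (prect_set p Q))%E.
  by rewrite integral_cst ?mul1e//; exact: measurable_prect.
rewrite -H integral_prect_partition //.
by apply: eq_bigr => k _; rewrite H.
Qed.

End partitions.

(** * Measure of the cells that meet [E] *)

Section free_cells.
Variables (R : realType) (n d : nat) (p b : R) (E : set ('rV[R]_n * R)).
Let mu := lebesgue_spacetime R n.
Let w := dist_weight p E b.
Hypothesis p1 : 1 < p.
Hypothesis dp9 : ln 9 / ln 2 <= d%:R * p.
Hypothesis b0 : 0 < b.
Hypothesis E0 : E !=set0.
Hypothesis mw : measurable_fun setT (w : 'rV[R]_n * measurableTypeR R -> \bar R).

Let w0 z : (0 <= w z)%E. Proof. exact: dist_weight_ge0. Qed.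

(* A cell that meets [E] lies within its own side length of [E], so the weight
   is large on it: the cells that are not free have small total measure. *)
Lemma free_cells (P : prect R n) (i : nat) : parabolic P ->
  exists N (S : 'I_N -> prect R n),
  [/\ forall k, [/\ dyadic p d P (S k), E_free p E (S k), parabolic (S k) &
        l_x (S k) = l_x P / 2 ^+ (d * i)],
      trivIset setT (fun k => prect_set p (S k)) &
      (mu (prect_set p P) <= \sum_(k < N) mu (prect_set p (S k)) +
        ((l_x P / 2 ^+ (d * i)) `^ b)%:E * \int[mu]_(z in prect_set p P) w z)%E].
Proof.
move=> pP; have [T [S [S1 S2 S3]]] := dyadic_gen_partition dp9 i pP.
set l := l_x P / _.
have lb0 : 0 < l `^ b by rewrite powR_gt0// divr_gt0 ?exprn_gt0//; case: pP.
pose F := [set k : T | `[< E_free p E (S k) >]]%SET.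
exists #|F|, (fun j => S (enum_val j)); split.
- move=> j; have [s1 s2 s3] := S1 (enum_val j); split => //.
    by exists i.
  by have := enum_valP j; rewrite inE => /asboolP.
- move=> j j' _ _ /(S2 _ _ I I); exact: enum_val_inj.
rewrite (lebesgue_prect_partition S2 S3) (bigID (fun k => k \in F))/=.
rewrite (big_enum_val (fun k => mu (prect_set p (S k)))) leeD2l//.
rewrite (integral_prect_partition S2 S3)//.
rewrite ge0_sume_distrr; last by move=> k _; exact: integral_ge0.
rewrite [leRHS](bigID (fun k => k \in F))/=.
apply: (@le_trans _ _ (\sum_(k | k \notin F) (l `^ b)%:E *
    \int[mu]_(z in prect_set p (S k)) w z)%E); last first.
  rewrite leeDr//; apply: sume_ge0 => k _; rewrite mule_ge0 ?lee_fin ?(ltW lb0)//.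
  exact: integral_ge0.
apply: lee_sum => k; rewrite inE => /asboolPn Fk; have [_ pk lk] := S1 k.
rewrite -lee_pdivrMl// -integral_cst; last exact: measurable_prect.
apply: ge0_le_integral => //; first exact: measurable_prect.
- by move=> z _; rewrite lee_fin invr_ge0 ltW.
- exact: measurable_funTS.
by move=> z Sz; rewrite /l -lk /cst; exact: dist_weight_nonfree.
Qed.

End free_cells.

(** * Bound for the weight over a whole rectangle *)

Section reverse.
Variables (R : realType) (n d : nat) (p gamma C theta b : R).
Variable E : set ('rV[R]_n * R).
Let mu := lebesgue_spacetime R n.
Let w := dist_weight p E b.
Hypothesis d0 : (0 < d)%N.
Hypothesis dp9 : ln 9 / ln 2 <= d%:R * p.
Hypothesis gamma01 : 0 < gamma < 1.
Hypothesis p1 : 1 < p.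
Hypothesis theta1 : 1 < theta.
Hypothesis b0 : 0 < b.
Hypothesis E0 : E !=set0.
Hypothesis C0 : 0 < C.
Hypothesis mw : measurable_fun setT (w : 'rV[R]_n * measurableTypeR R -> \bar R).
Hypothesis wA1 : forall (x : 'rV[R]_n) (t L : R), 0 < L ->
  ((mu (Rminus p x t L gamma))^-1 * \int[mu]_(z in Rminus p x t L gamma) w z
   <= C%:E * ess_inf_on (Rplus p x t L gamma) w)%E.

(** The chain bound controls boxes whose side is only known to be at least [kappa * l_x P]. So [P]
    is cut into equal dyadic cells small enough to lie in the box about their own centre, and the
    bounds are summed. *)
Lemma integral_prect_le : exists2 K : R, 0 < K & forall P M : prect R n,
  parabolic P -> parabolic M ->
  prect_set p M `<=` prect_set p (time_shift p theta P) -> E_free p E M ->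
  (\int[mu]_(z in prect_set p P) w z <=
   (K * (l_x M `^ b)^-1)%:E * mu (prect_set p P))%E.
Proof.
have [g0 g1] := andP gamma01; have p0 : 0 < p := lt_trans ltr01 p1.
have [K [kappa [K0 kappa0 HK]]] := integral_box_le gamma01 p1 theta1 b0 E0 C0 mw wA1.
have g4 : 0 < (1 - gamma) / 4 by lra.
(* Cells of side at most (1 - gamma) / 4 * l fit in the box in space and, since p > 1, also in
   time. *)
have [i ri] := exists_inv_pow_le d0 (mulr_gt0 g4 kappa0).
set r : R := (2 ^+ (d * i))^-1 in ri.
have r0 : 0 < r by rewrite invr_gt0 exprn_gt0.
have rn0 : 0 < r ^+ n * r `^ p by rewrite mulr_gt0 ?exprn_gt0 ?powR_gt0.
exists (K * (2 / (r ^+ n * r `^ p)) * 8 `^ b).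
  by rewrite mulr_gt0 ?powR_gt0// mulr_gt0// divr_gt0.
move=> P M pP pM MP fM; have [T [S [S1 S2 S3]]] := dyadic_gen_partition dp9 i pP.
rewrite (lebesgue_prect_partition S2 S3) (integral_prect_partition S2 S3 (dist_weight_ge0 p E b) mw).
have M0 : 0 < l_x M by case: pM.
have c0 : 0 <= K * (2 / (r ^+ n * r `^ p)) * 8 `^ b * (l_x M `^ b)^-1.
  by rewrite !mulr_ge0 ?invr_ge0 ?powR_ge0 ?(ltW K0) ?(ltW rn0).
rewrite ge0_sume_distrr; last by move=> k _; exact: measure_ge0.
apply: lee_sum => k _; have [_ pQ lQ] := S1 k; set Q := S k in pQ lQ *.
have {}lQ : l_x Q = l_x P * r by [].
have L0 : 0 < l_x P by case: pP.
have Qc := prect_center p pQ.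
have QP : prect_set p Q `<=` prect_set p P by rewrite -S3 => z Qz; exists k.
have [l [kl Il]] := HK P M _ pP pM MP fM (QP _ Qc).
have l0 : 0 < l by apply: lt_le_trans kl; rewrite mulr_gt0.
have Ql : l_x Q <= (1 - gamma) / 4 * l.
  apply: (@le_trans _ _ ((1 - gamma) / 4 * (kappa * l_x P))).
    by rewrite lQ mulrC mulrA ler_wpM2r// ltW.
  by rewrite ler_wpM2l// ltW.
have Qlp : l_x Q `^ p <= (1 - gamma) / 4 * l `^ p.
  apply: (@le_trans _ _ (((1 - gamma) / 4 * l) `^ p)).
    by rewrite (ler_powRr p0) ?(mulr_ge0 (ltW g4) (ltW l0)) ?(ltW pQ.1).
  by apply: ge1r_powRZ; rewrite ?(ltW l0) ?(ltW p1)// g4; lra.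
have Qbox : prect_set p Q `<=` centered_box p gamma (ctr_x Q)
     (t_top Q - l_x Q `^ p + l_t p Q / 2) l.
  move=> [x t] [/= xQ tQ]; split => /= [j|].
    have : (1 - gamma) * l <= l by rewrite ger_pMl//; lra.
    by have := xQ j => /andP[? ?] ?; apply/andP; split; lra.
  have lp0 := powR_gt0 p l0.
  have glp : 0 < (1 - gamma) * l `^ p by rewrite mulr_gt0//; lra.
  have /andP[q1 q2] := l_t_bounds p pQ; have q0 := l_t_gt0 p pQ.
  move: tQ => /andP[t1 t2]; rewrite ltr_norml; move: q1 q2 q0; rewrite /l_t.
  by move=> *; apply/andP; split; lra.
have mQ : measurable (prect_set p Q : set ('rV[R]_n * measurableTypeR R)).
  exact: measurable_prect.
apply: (@le_trans _ _ (\int[mu]_(z in centered_box p gamma (ctr_x Q)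
     (t_top Q - l_x Q `^ p + l_t p Q / 2) l) w z)%E).
  apply: ge0_subset_integral => //.
  - exact: measurable_centered_box.
  - exact: measurable_funTS.
  - by move=> z _; exact: dist_weight_ge0.
apply: (le_trans Il).
have /andP[muQ _] := lebesgue_prect_bounds p pQ.
apply: (le_trans _ (lee_wpmul2l _ muQ)); last by rewrite lee_fin.
rewrite -EFinM lee_fin lQ exprMn (powRM _ (ltW L0) (ltW r0)).
rewrite powRM ?(ltW M0) ?invr_ge0//.
have e8 : (8^-1 : R) `^ b = (8 `^ b)^-1.
  by rewrite -powR_inv1// powRAC powR_inv1// powR_ge0.
rewrite e8 le_eqVlt; apply/orP; left; apply/eqP.
have Mb0 := powR_gt0 b M0.
have e0 : 0 < 8 `^ b :> R by rewrite powR_gt0.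
have rp0 := powR_gt0 p r0.
by field; rewrite !gt_eqF//= ?exprn_gt0.
Qed.

End reverse.

(** * Weak porosity *)

(** The half-open rectangle lies in a closed box, which is compact. *)
Lemma integral_prect_lty (R : realType) (n : nat) (p : R)
    (w : 'rV[R]_n * R -> \bar R) (P : prect R n) :
  (forall z, (0 <= w z)%E) -> L1loc w ->
  (\int[lebesgue_spacetime R n]_(z in prect_set p P) w z < +oo)%E.
Proof.
move=> w0 [mw wK].
pose Jx i := `[ctr_x P ord0 i - l_x P / 2, ctr_x P ord0 i + l_x P / 2].
pose Jt := `[t_top P - l_x P `^ p, t_top P - truncation P * l_x P `^ p].
pose K : set ('rV[R]_n * R) :=
  [set x : 'rV[R]_n | forall i, [set` Jx i] (x ord0 i)] `*` [set` Jt].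
have cK : compact K.
  apply: compact_setX; last exact: segment_compact.
  by apply: (@rV_compact _ _ (fun i => [set` Jx i])) => i; exact: segment_compact.
apply: le_lt_trans (wK _ cK).
under [leRHS]eq_integral do rewrite gee0_abs//.
apply: ge0_subset_integral => //.
- exact: measurable_prect.
- by apply: measurableX => //; exact: measurable_rV_box.
- exact: measurable_funTS.
move=> [x t] [/= xP /andP[t1 t2]]; split => /= [i|].
  by rewrite in_itv/=; have /andP[-> /ltW] := xP i.
by rewrite in_itv/= t1 ltW.
Qed.

Lemma largest_freeP (R : realType) (n d : nat) (p : R)
    (E : set ('rV[R]_n * R)) (P : prect R n) :
  largest_free p d E P = set0 \/
  exists M, [/\ dyadic p d P M, E_free p E M &
    largest_free p d E P = prect_set p M].
Proof.
rewrite /largest_free; case: xgetP => [X XE [M [[dM fM _] _] MX]|_]; last by left.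
by right; exists M; rewrite MX.
Qed.

Section porosity.
Variables (R : realType) (n d : nat) (p gamma C theta alpha : R).
Variable E : set ('rV[R]_n * R).
Let mu := lebesgue_spacetime R n.
Let D := n%:R + p.
Let b := alpha * D.
Let w := dist_weight p E b.
Hypothesis d0 : (0 < d)%N.
Hypothesis dp9 : ln 9 / ln 2 <= d%:R * p.
Hypothesis gamma01 : 0 < gamma < 1.
Hypothesis p1 : 1 < p.
Hypothesis theta1 : 1 < theta.
Hypothesis alpha0 : 0 < alpha.
Hypothesis E0 : E !=set0.
Hypothesis C0 : 0 < C.
Hypothesis wL1 : L1loc w.
Hypothesis wA1 : forall (x : 'rV[R]_n) (t L : R), 0 < L ->
  ((mu (Rminus p x t L gamma))^-1 * \int[mu]_(z in Rminus p x t L gamma) w z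
   <= C%:E * ess_inf_on (Rplus p x t L gamma) w)%E.
Implicit Types P Q : prect R n.

Let p0 : 0 < p. Proof. exact: lt_trans ltr01 p1. Qed.
Let D0 : 0 < D. Proof. by rewrite /D ltr_wpDl. Qed.
Let b0 : 0 < b. Proof. by rewrite mulr_gt0. Qed.

Let powD (l : R) : 0 < l -> l ^+ n * l `^ p = l `^ D.
Proof.
move=> l0; rewrite /D powRD ?powR_mulrn ?(ltW l0)//.
by rewrite (gt_eqF l0) implybT.
Qed.

Let prect_le_D P : parabolic P -> (mu (prect_set p P) <= (l_x P `^ D)%:E)%E.
Proof.
by move=> pP; have /andP[_] := lebesgue_prect_bounds p pP; rewrite powD//; case: pP.
Qed.

Let prect_ge_D P : parabolic P -> ((l_x P `^ D / 2)%:E <= mu (prect_set p P))%E.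
Proof.
by move=> pP; have /andP[+ _] := lebesgue_prect_bounds p pP; rewrite powD//; case: pP.
Qed.

Let cell_le P (a : R) : parabolic P -> 0 < a ->
  exists i, l_x P / 2 ^+ (d * i) <= a.
Proof.
move=> [L0 _] a0; have [i ri] := exists_inv_pow_le d0 (divr_gt0 a0 L0).
by exists i; rewrite mulrC -ler_pdivlMr.
Qed.

(** The generation is the last one whose cells satisfy l^D >= 2 delta |M|, with D = n + p. These
    cells are admissible, and failure one generation later bounds l^D by a multiple of delta |M|;
    raising to the power alpha gives (l / l_x(M))^b = O(delta^alpha), because b = alpha D. *)
Lemma exists_scale : exists2 K : R, 0 < K & forall delta P,
  0 < delta <= 1 / 2 -> parabolic P -> exists i : nat,
  (forall Q, parabolic Q -> l_x Q = l_x P / 2 ^+ (d * i) ->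
    (delta%:E * mu (largest_free p d E (time_shift p theta P))
     <= mu (prect_set p Q))%E) /\
  (((l_x P / 2 ^+ (d * i)) `^ b)%:E * \int[mu]_(z in prect_set p P) w z
   <= (K * delta `^ alpha)%:E * mu (prect_set p P))%E.
Proof.
have [K K0 HK] := integral_prect_le d0 dp9 gamma01 p1 theta1 b0 E0 C0 wL1.1 wA1.
(* The factor (2^d)^D is lost between consecutive generations, and 2 comes from |Q| >= l^D / 2. *)
pose q : R := (2 ^+ d) `^ D * 2.
have q0 : 0 < q by rewrite mulr_gt0// powR_gt0// exprn_gt0.
exists (K * q `^ alpha); first by rewrite mulr_gt0// powR_gt0.
move=> delta P /andP[delta0 delta1] pP.
have L0 : 0 < l_x P by case: pP.
have w0 z : (0 <= w z)%E by exact: dist_weight_ge0.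
have c0 : 0 < K * q `^ alpha * delta `^ alpha by rewrite !mulr_gt0 ?powR_gt0.
have [->|[M [dM fM ->]]] := largest_freeP d p E (time_shift p theta P).
  have muP := lebesgue_prect p pP; set m := _ * _ in muP.
  have m0 : 0 < m by rewrite mulr_gt0 ?exprn_gt0 ?l_t_gt0.
  have := integral_prect_lty p P w0 wL1.
  have : (0 <= \int[mu]_(z in prect_set p P) w z)%E by exact: integral_ge0.
  rewrite -/mu; case: (integral _ _ _) => // r r0 _; rewrite lee_fin in r0.
  (* Here there is no largest free rectangle, so only the integral restricts [l]. It has a finite
     value [r], and dividing by [r + 1] covers r = 0. *)
  pose a := K * q `^ alpha * delta `^ alpha * m / (r + 1).
  have a0 : 0 < a by rewrite divr_gt0 ?(mulr_gt0 c0 m0)// ltr_wpDl.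
  have [i ri] := cell_le pP (powR_gt0 b^-1 a0).
  exists i; split; first by move=> Q _ _; rewrite measure0 mule0; exact: measure_ge0.
  rewrite muP -!EFinM lee_fin.
  have l0 : 0 < l_x P / 2 ^+ (d * i) by rewrite divr_gt0// exprn_gt0.
  apply: (@le_trans _ _ (a * r)).
    rewrite ler_wpM2r// -[leRHS](powRK b0 (ltW a0)) (ler_powRr b0)//.
    - exact: ltW.
    - exact: powR_ge0.
  rewrite /a -mulrA ler_piMr//; first exact/ltW/mulr_gt0.
  by rewrite mulrC ler_pdivrMr ?mul1r ?lerDl// ltr_wpDl.
have psP : parabolic (time_shift p theta P) by case: pP.
have [pM MP] := dyadic_sub dp9 psP dM.
have [V muM] : exists V, mu (prect_set p M) = V%:E.
  by eexists; exact: lebesgue_prect.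
have V0 : 0 < V.
  rewrite -lte_fin -muM; apply: lt_le_trans (prect_ge_D pM).
  by rewrite lte_fin divr_gt0// powR_gt0//; case: pM.
have VM : V <= l_x M `^ D by rewrite -lee_fin -muM prect_le_D.
have VL : V <= l_x P `^ D.
  rewrite -lee_fin -muM; apply: le_trans (prect_le_D psP).
  by apply: le_measure; rewrite ?inE//; exact: measurable_prect.
have dV0 : 0 < delta * V by rewrite mulr_gt0.
have ex_i : exists i, (l_x P / 2 ^+ (d * i)) `^ D < 2 * (delta * V).
  have [i ri] := cell_le pP (powR_gt0 D^-1 dV0); exists i.
  apply: (@le_lt_trans _ _ (delta * V)); last by lra.
  rewrite -[leRHS](powRK D0 (ltW dV0)) (ler_powRr D0) ?powR_ge0//.
  by rewrite divr_ge0 ?(ltW L0)// exprn_ge0.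
(* The first generation with l^D < 2 delta |M| is not generation 0, because 2 delta <= 1 and |M| <=
   L^D. Its predecessor is the generation sought. *)
case: (ex_minnP ex_i) => -[|i] iP imin.
  have : V * delta <= V * (1 / 2) by rewrite ler_wpM2l// ltW.
  by move: iP; rewrite muln0 expr0 divr1; lra.
exists i; set l := l_x P / _.
have l0 : 0 < l by rewrite divr_gt0// exprn_gt0.
have li : 2 * (delta * V) <= l `^ D.
  by rewrite leNgt; apply/negP => /imin; rewrite ltnn.
split.
  move=> Q pQ lQ; rewrite muM -EFinM; apply: le_trans (prect_ge_D pQ).
  by rewrite lee_fin lQ -/l ler_pdivlMr// mulrC.
apply: le_trans (lee_wpmul2l _ (HK P M pP pM MP fM)) _.
  by rewrite lee_fin powR_ge0.
rewrite muleA -EFinM; apply: lee_wpmul2r; first exact: measure_ge0.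
have M0 : 0 < l_x M by case: pM.
have Mb0 := powR_gt0 b M0.
rewrite lee_fin mulrCA -!mulrA ler_wpM2l ?(ltW K0)// ler_pdivrMr//.
have bE x : x `^ b = (x `^ D) `^ alpha by rewrite /b mulrC powRrM.
rewrite !bE -!powRM ?mulr_ge0 ?powR_ge0 ?(ltW q0) ?(ltW delta0)//.
rewrite (ler_powRr alpha0) ?mulr_ge0 ?powR_ge0 ?(ltW q0) ?(ltW delta0)//.
have -> : l = 2 ^+ d * (l_x P / 2 ^+ (d * i.+1)).
  by rewrite /l mulnS exprD; field; rewrite !expf_neq0.
rewrite powRM ?exprn_ge0//; last by rewrite divr_ge0 ?exprn_ge0 ?(ltW L0).
rewrite /q -!mulrA ler_wpM2l ?powR_ge0//.
apply: (le_trans (ltW iP)); rewrite ler_wpM2l// ler_wpM2l//; exact: ltW.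
Qed.

(** The lower constant may be nonpositive at this stage; its sign is settled later by the choice of
    [delta0]. *)
Lemma weakly_porous_of_bound : exists2 K : R, 0 < K & forall delta,
  0 < delta <= 1 / 2 ->
  weakly_porous p d E (1 - K * delta `^ alpha) delta theta.
Proof.
have [K K0 HK] := exists_scale; exists K => // delta delta01 mu0 P pP.
have [i [iQ iP]] := HK delta P delta01 pP.
have [N [S [S1 S2 S3]]] := free_cells p1 dp9 b0 E0 wL1.1 i pP.
exists N, S; split => //.
- by move=> k; have [] := S1 k.
- by move=> k; have [_ _ pk lk] := S1 k; exact: iQ.
(* This reads |P| <= (measure of the free cells) + K delta^alpha |P|. *)
have := le_trans S3 (leeD2l _ iP).
rewrite -/mu lebesgue_prect// {}/mu0 -!EFinM; set m := _ * _; set s := (\sum_(_ < _) _)%E.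
have : (0 <= s)%E by apply: sume_ge0 => k _; exact: measure_ge0.
case: s => // [s|]; rewrite ?leey// !lee_fin; lra.
Qed.

End porosity.

Theorem theorem3p8 (R : realType) (n d : nat) (p theta alpha gamma : R)
    (E : set ('rV[R]_n * R)) :
  (1 <= n)%N -> (1 <= d)%N -> 1 < p -> ln 9 / ln 2 <= d%:R * p ->
  E !=set0 -> closed E ->
  1 < theta -> 0 < alpha -> 0 < gamma < 1 ->
  A1plus p gamma (dist_weight p E (alpha * (n%:R + p))) ->
  exists c0 delta0 : R,
  [/\ 0 < c0 < 1,
      0 < delta0 < 1,
      weakly_porous p d E c0 delta0 theta &
      exists2 C : R, 0 < C &
      forall delta : R, 0 < delta <= delta0 ->
      exists c : R, [/\ 0 < c < 1,
        weakly_porous p d E c delta theta &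
        1 - c <= C * delta `^ alpha]].
Proof.
move=> _ d0 p1 dp9 E0 _ theta1 alpha0 gamma01 [_ wL1 [C C0 wA1]].
have [K K0 HK] := weakly_porous_of_bound d0 dp9 gamma01 p1 theta1 alpha0 E0 C0 wL1 wA1.
have a0 : 0 < (2 * K)^-1 by rewrite invr_gt0 mulr_gt0.
(* The second bound forces K delta^alpha <= 1/2, so the porosity constant lies in [1/2, 1). *)
pose delta0 : R := Num.min (1 / 2) ((2 * K)^-1 `^ alpha^-1).
have [dl1 dl2] : delta0 <= 1 / 2 /\ delta0 <= (2 * K)^-1 `^ alpha^-1.
  by split; rewrite ge_min lexx ?orbT.
have delta0_gt0 : 0 < delta0 by rewrite lt_min powR_gt0// andbT; lra.
clearbody delta0.
have c01 delta : 0 < delta <= delta0 ->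
    0 < 1 - K * delta `^ alpha < 1 /\ 0 < delta <= 1 / 2.
  move=> /andP[delta_gt0 dd]; split; last by rewrite delta_gt0 (le_trans dd).
  have : K * delta `^ alpha <= K * (2 * K)^-1.
    rewrite ler_wpM2l ?(ltW K0)// -[leRHS](powRK alpha0 (ltW a0)).
    rewrite (ler_powRr alpha0) ?powR_ge0 ?(ltW delta_gt0)//.
    exact: le_trans dd dl2.
  have -> : K * (2 * K)^-1 = 1 / 2 by field; rewrite gt_eqF.
  have : 0 < K * delta `^ alpha by rewrite mulr_gt0// powR_gt0.
  by move=> ? ?; apply/andP; split; lra.
have dd0 : 0 < delta0 <= delta0 by rewrite delta0_gt0 lexx.
exists (1 - K * delta0 `^ alpha), delta0; split.
- by have [] := c01 _ dd0.
- by rewrite delta0_gt0/=; lra.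
- by apply: HK; have [] := c01 _ dd0.
- exists K => // delta dd; exists (1 - K * delta `^ alpha).
  have [c1 c2] := c01 _ dd; split => //; first exact: HK.
  by rewrite subKr.
Qed.
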